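(* Let $n\ge2$ and let $B$ be a homothecy invariant convex density basis in $\mathbb{R}^n$. Then $B$ differentiates the class $L^p(\mathbb{R}^n)\cap L(\mathbb{R}^n)$ for all sufficiently large $p$; that is, there is $p_0<\infty$ such that $B$ differentiates $L^p(\mathbb{R}^n)\cap L(\mathbb{R}^n)$ for every $p\in[p_0,\infty)$.
   Context: $L(\mathbb{R}^n)=L^1(\mathbb{R}^n)$ is the class of Lebesgue integrable functions on $\mathbb{R}^n$; $|E|$ is Lebesgue measure. A differentiation basis (basis) $B$ in $\mathbb{R}^n$ is a mapping assigning to each $x\in\mathbb{R}^n$ a family $B(x)$ of bounded measurable sets of positive measure containing $x$, such that there is a sequence $(R_k)$ in $B(x)$ with $\operatorname{diam}R_k\to 0$. For $f\in L(\mathbb{R}^n)$, $\overline{D}_B(\int f,x)$ and $\underline{D}_B(\int f,x)$ denote the upper and lower limits of $\frac{1}{|R|}\int_R f$ over $R\in B(x)$ as $\operatorname{diam}R\to 0$. $B$ differentiates $\int f$ if $\overline{D}_B(\int f,x)=\underline{D}_B(\int f,x)=f(x)$ for almost all $x$; $B$ differentiates a class $F\subset L(\mathbb{R}^n)$ if it differentiates $\int f$ for every $f\in F$. $B$ is homothecy invariant if $R\in B(x)$ implies $H(R)\in B(H(x))$ for every homothecy $H$ of $\mathbb{R}^n$ (maps $x\mapsto a+t(x-a)$ with $a\in\mathbb{R}^n$, $t>0$; a homothecy invariant basis is then also translation invariant); convex if all sets in all $B(x)$ are convex; a density basis if $B$ differentiates $\int\chi_E$ for every bounded measurable set $E\subset\mathbb{R}^n$.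 *)

(* Defs.v *)
From HB Require Import structures.
From mathcomp Require Import all_boot all_order all_algebra.
From mathcomp Require Import all_classical all_reals all_analysis.

Set Implicit Arguments.
Unset Strict Implicit.
Unset Printing Implicit Defensive.

Import Order.TTheory GRing.Theory Num.Theory.
Import numFieldNormedType.Exports.

Local Open Scope classical_set_scope.
Local Open Scope ring_scope.

Section lebesgue_outer.
Context (R : realType) (n : nat).
Implicit Types (A : set 'rV[R]_n) (I : 'rV[R]_n * 'rV[R]_n).

Definition open_box I : set 'rV[R]_n :=
  [set x | forall i, I.1 ord0 i < x ord0 i < I.2 ord0 i].

Definition box_volume I : R :=
  \prod_(i < n) Num.max 0 (I.2 ord0 i - I.1 ord0 i).

(* Countable (possibly finite) families of boxes, each box I being coded by its
   two extreme corners; it is empty as soon as I.2 is below I.1 somewhere. *)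
Definition box_cover A : set (set ('rV[R]_n * 'rV[R]_n)) :=
  [set C | countable C /\ A `<=` \bigcup_(I in C) open_box I].

Definition lebesgue_outer A : \bar R :=
  ereal_inf [set \esum_(I in C) (box_volume I)%:E | C in box_cover A].

Local Open Scope ereal_scope.

Lemma box_volume_ge0 I : 0 <= (box_volume I)%:E.
Proof. by rewrite lee_fin prodr_ge0// => i _; rewrite le_max lexx. Qed.

Lemma lebesgue_outer_ge0 A : 0 <= lebesgue_outer A.
Proof.
by apply: le_ereal_inf_tmp => _ [C _ <-]; apply: esum_ge0 => I _; exact: box_volume_ge0.
Qed.

Lemma lebesgue_outer0 : lebesgue_outer set0 = 0.
Proof.
apply/eqP; rewrite eq_le lebesgue_outer_ge0 andbT.
apply: ereal_inf_lbound; exists set0; last by rewrite esum_set0.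
by split => //; exact: countable0.
Qed.

Lemma le_lebesgue_outer : {homo lebesgue_outer : A B / A `<=` B >-> A <= B}.
Proof.
move=> A B AB; apply/ereal_inf_le_tmp => _ [C [cC BC] <-].
by exists C => //; split => //; exact: subset_trans BC.
Qed.

Lemma lebesgue_outer_sigma_subadditive : sigma_subadditive lebesgue_outer.
Proof.
move=> A; have [[i ioo]|] := pselect (exists i, lebesgue_outer (A i) = +oo).
  rewrite (eseries_pinfty _ _ ioo) ?leey// => k _.
  by rewrite -ltNye (lt_le_trans _ (lebesgue_outer_ge0 _)).
rewrite -forallNE => Aoo.
suff add2e (e : {posnum R}) : lebesgue_outer (\bigcup_k A k) <=
    \sum_(i <oo) lebesgue_outer (A i) + e%:num%:E.
  by apply/lee_addgt0Pr => _/posnumP[].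
rewrite (le_trans _ (epsilon_trick _ _ _))//; last first.
  by move=> k; exact: lebesgue_outer_ge0.
pose P k C := box_cover (A k) C /\ \esum_(I in C) (box_volume I)%:E <=
  lebesgue_outer (A k) + (e%:num / (2 ^ k.+1)%:R)%:E.
have [G PG] : {G : nat -> set ('rV[R]_n * 'rV[R]_n) & forall k, P k (G k)}.
  apply: (@choice _ _ P) => k; rewrite /P.
  have fA : lebesgue_outer (A k) \is a fin_num.
    by rewrite ge0_fin_numE ?lebesgue_outer_ge0// ltey; apply/eqP/Aoo.
  have ek : (0 < e%:num / (2 ^ k.+1)%:R :> R)%R by [].
  have [_ [C AC <-] xS] := lb_ereal_inf_adherent ek fA.
  by exists C; split => //; exact/ltW.
have vol_ge0 I := box_volume_ge0 I.
apply: (@le_trans _ _ (\esum_(I in \bigcup_k G k) (box_volume I)%:E)).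
  apply: ereal_inf_lbound; exists (\bigcup_k G k) => //; split.
    by apply: bigcup_countable => // k _; have [[]] := PG k.
  move=> x [k _ /(PG k).1.2[I GI xI]].
  by exists I => //; exists k.
rewrite seqDU_bigcup_eq esum_bigcupT//.
rewrite nneseries_esumT; last first.
  by move=> k; rewrite adde_ge0 ?lebesgue_outer_ge0// lee_fin divr_ge0.
apply: le_esum => k _; apply: le_trans (PG k).2.
apply: ereal_sup_le => _ [X [fX XG] <-].
exists X => //; split => //; exact: subset_trans XG (@subDsetl _ _ _).
Qed.

HB.instance Definition _ := isOuterMeasure.Build R 'rV[R]_n lebesgue_outer
  lebesgue_outer0 lebesgue_outer_ge0 le_lebesgue_outer
  lebesgue_outer_sigma_subadditive.

End lebesgue_outer.

Definition lebesgue_outer_measure (R : realType) (n : nat) :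
    {outer_measure set 'rV[R]_n -> \bar R} := @lebesgue_outer R n.

(* 'rV[R]_n with the sigma-algebra of all Lebesgue measurable sets (not only
   the Borel sets), given by the Caratheodory criterion. *)
Notation lebesgue_type R n := (caratheodory_type (lebesgue_outer_measure R n)).

Definition lebesgue (R : realType) (n : nat) :
    {measure set (lebesgue_type R n) -> \bar R} :=
  (lebesgue_outer_measure R n : set (lebesgue_type R n) -> \bar R).

Section differentiation.
Context (R : realType) (n : nat).
Implicit Types (B : 'rV[R]_n -> set (set 'rV[R]_n)) (E : set 'rV[R]_n).
Implicit Types (f : 'rV[R]_n -> R) (x : 'rV[R]_n).

Local Notation mu := (lebesgue R n).

(* The library norm on 'rV[R]_n is the sup norm; bounded_set below refers to
   it, which is harmless by equivalence of norms, but diam is Euclidean. *)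
Definition euclidean_norm x : R := Num.sqrt (\sum_i x ord0 i ^+ 2).

Definition diam E : \bar R :=
  ereal_sup [set (euclidean_norm (x - y))%:E | x in E & y in E].

Definition differentiation_basis B := forall x,
  (forall E, B x E ->
     [/\ bounded_set E, measurable (E : set (lebesgue_type R n)),
         (0 < mu E)%E & E x]) /\
  exists E_ : nat -> set 'rV[R]_n,
    (forall k, B x (E_ k)) /\ diam (E_ k) @[k --> \oo] --> 0%E.

Definition average f E : \bar R := ((mu E)^-1 * \int[mu]_(y in E) (f y)%:E)%E.

Definition small_sets B x (d : R) : set (set 'rV[R]_n) :=
  [set E | B x E /\ (diam E < d%:E)%E].

Definition upper_derivative B f x : \bar R :=
  ereal_inf [set ereal_sup (average f @` small_sets B x d) | d in [set d | 0 < d]].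

Definition lower_derivative B f x : \bar R :=
  ereal_sup [set ereal_inf (average f @` small_sets B x d) | d in [set d | 0 < d]].

Definition differentiates B f :=
  {ae mu, forall x, upper_derivative B f x = (f x)%:E /\
                    lower_derivative B f x = (f x)%:E}.

Definition differentiates_class B (F : set ('rV[R]_n -> R)) :=
  forall f, F f -> differentiates B f.

Definition homothecy (a : 'rV[R]_n) (t : R) x : 'rV[R]_n := a + t *: (x - a).

Definition homothecy_invariant B := forall a t x E, 0 < t ->
  B x E -> B (homothecy a t x) (homothecy a t @` E).

Definition convex_basis B := forall x E, B x E -> convex_set E.

Definition density_basis B := forall E,
  bounded_set E -> measurable (E : set (lebesgue_type R n)) ->
  differentiates B \1_E.

Definition Lp (p : \bar R) : set ('rV[R]_n -> R) := [set` Lfun mu p].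

End differentiation.

(* Main.v *)
Require Import Defs.
From HB Require Import structures.
From mathcomp Require Import all_boot all_order all_algebra.
From mathcomp Require Import all_classical all_reals all_analysis measurable_realfun.
From mathcomp Require Import perm ring lra.

(** By homothecy invariance [B x = x + B 0], and all the estimates concern the
    halos [{x | |E /\ (x + S)| > l |S| for some S in B 0}] of open sets [E], which
    are open. A Borel-Cantelli argument and a covering of a cube by greedily
    chosen translates turn the density property into the weak type bounds
    [|halo l E| <= C_l |E|] for every [l > 0].

    Each convex [S] contains a translate of [K / (6 n)] for a symmetric convex
    body [K] containing [S]. Two passes of halos, for [B 0] and for its
    reflection, give an operator [expand] with [|expand E| <= C |E|] such that
    [expand E] contains every [x + K] in which [E] has at least a fixed density.
    If [E] has density at most [1/2] in [Q = x + K], then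
    [|expand E /\ Q| >= (1 + 1/C) |E /\ Q|]. Hence a density [l] in [Q] is raised to
    full inclusion by [O(log (1/l))] expansions, and [C_l] is at most a power
    [l^-q]. This restricted weak type bound, applied to the level sets
    [{|f| >= 2^j}], controls the unbounded part of [f] in [L^p] for large [p]; the
    bounded part is handled by density points of the sets [{q1 < f <= q2}]. *)

Set Implicit Arguments.
Unset Strict Implicit.
Unset Printing Implicit Defensive.

Import Order.TTheory GRing.Theory Num.Theory.
Import numFieldNormedType.Exports.

Local Open Scope classical_set_scope.
Local Open Scope ring_scope.

(** * Invariance properties of Lebesgue outer measure *)

(** The argument by contradiction behind the weak type bounds gives no control of [C_l] as [l] tends
    to 0, whereas summing over the level sets of [f] requires a rate. The rate comes from using
    these bounds at two fixed levels only and iterating. Two facts make this possible: convexity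
    bounds the loss in passing from [S] to [K] by a constant depending on [n] alone, and the copies
    of [x + K] shrinking to one of its points are nested, so that a point of [E] in a [Q] of low
    density has a copy around it where the density of [E] is neither small nor above 1/2. While the
    density in [Q] is at most 1/2, one expansion multiplies it by at least [1 + 1/C] and the measure
    of the whole set by at most [C], whence [q = log C / log (1 + 1/C)] up to rounding. The bounds
    are stated for open sets, whose halos are again open and thus measurable; other sets are reached
    by outer regularity. *)

Section lebesgue_outer_basics.
Context (R : realType) (n : nat).
Implicit Types (A E : set 'rV[R]_n) (I : 'rV[R]_n * 'rV[R]_n).

Local Notation leb := (lebesgue_outer_measure R n).
Local Notation LT := (lebesgue_type R n).

Local Open Scope ereal_scope.

(** Subadditivity is stated for sequences; an injection of [C] into the natural numbers turns the
    family into one, with [G k] empty when [k] is not a value of the injection. *)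
Lemma outer_measure_le_esum (J : choiceType) (C : set J)
    (F : J -> set 'rV[R]_n) A :
  countable C -> A `<=` \bigcup_(i in C) F i ->
  leb A <= \esum_(i in C) leb (F i).
Proof.
move=> /countable_injP[f finj] AF.
pose G k := \bigcup_(i in C `&` [set i | f i = k]) F i.
have GF i : C i -> G (f i) = F i.
  move=> Ci; apply/seteqP; split => [x [j [Cj /= fji] Fjx]|x Fix].
    by rewrite -(finj j i _ _ fji)// inE.
  by exists i.
apply: (@le_trans _ _ (leb (\bigcup_k G k))).
  by apply: le_outer_measure => x /AF[i Ci Fx]; exists (f i) => //; rewrite GF.
apply: le_trans (outer_measure_sigma_subadditive _ _) _.
rewrite nneseries_esumT//.
rewrite (eq_esum (b := fun i => leb (G (f i)))); last by move=> i Ci; rewrite GF.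
rewrite -(@esum_image _ _ _ C f (fun k => leb (G k)))//.
rewrite [leRHS]esum_mkcond.
apply: le_esum => k _.
case: ifPn => // /negP fk.
rewrite (_ : G k = set0) ?outer_measure0//.
apply/seteqP; split => // x [i [Ci /= fik] _]; apply: fk.
by rewrite inE; exists i.
Qed.

Lemma lebesgue_outer_open_box I : leb (open_box I) <= (box_volume I)%:E.
Proof.
apply: ereal_inf_lbound; exists [set I]; last first.
  by rewrite esum_set1// box_volume_ge0.
by split; [exact: countable1 | move=> x Ix; exists I].
Qed.

(** The outer measure is an infimum over covers by open boxes, so an estimate for images of boxes
    passes to images of all sets. *)
Lemma lebesgue_outer_image_le (phi : 'rV[R]_n -> 'rV[R]_n) (c : R) A :
  (0 < c)%R ->
  (forall I, leb (phi @` open_box I) <= (c * box_volume I)%:E) ->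
  leb (phi @` A) <= c%:E * leb A.
Proof.
move=> c0 phiI.
rewrite -lee_pdivrMl//; apply: le_ereal_inf_tmp => _ [C [cC AC] <-].
rewrite lee_pdivrMl//.
apply: le_trans (outer_measure_le_esum (F := fun I => phi @` open_box I) cC _) _.
  by move=> _ [x /AC[I CI Ix] <-]; exists I => //; exists x.
apply: ge_ereal_sup => _ [X CX <-].
apply: (@le_trans _ _ (c%:E * \sum_(I \in X) (box_volume I)%:E)); last first.
  apply: lee_wpmul2l; first by rewrite lee_fin ltW.
  by apply: esum_ge; exists X.
rewrite ge0_mule_fsumr; last by move=> I; exact: box_volume_ge0.
apply: lee_fsum; first exact: CX.1.
by move=> I _; rewrite -EFinM.
Qed.

Local Close Scope ereal_scope.

Lemma lebesgue_outer_affine_le (a : 'rV[R]_n) (t : R) A : 0 < t ->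
  (leb ((fun x => a + t *: x)%R @` A) <= (t ^+ n)%:E * leb A)%E.
Proof.
move=> t0; apply: lebesgue_outer_image_le => [|I]; first exact: exprn_gt0.
apply: (@le_trans _ _ (leb (open_box (a + t *: I.1, a + t *: I.2)))).
  apply: le_outer_measure => _ [x Ix <-] i /=; have /andP[xi1 xi2] := Ix i.
  by rewrite !mxE !ltrD2l !ltr_pM2l// xi1 xi2.
apply: le_trans (lebesgue_outer_open_box _) _.
rewrite lee_fin /box_volume /= -[in t ^+ n](card_ord n) -prodr_const -big_split/=.
rewrite le_eqVlt; apply/orP; left; apply/eqP; apply: eq_bigr => i _.
rewrite !mxE maxr_pMr ?(ltW t0)// mulr0 opprD addrACA subrr add0r.
by rewrite mulrBr.
Qed.

Lemma lebesgue_outer_affine (a : 'rV[R]_n) (t : R) A : 0 < t ->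
  leb ((fun x => a + t *: x)%R @` A) = ((t ^+ n)%:E * leb A)%E.
Proof.
move=> t0; apply/eqP; rewrite eq_le lebesgue_outer_affine_le//=.
have tn0 : 0 < t ^+ n by exact: exprn_gt0.
have tK x : - (t^-1 *: a) + t^-1 *: (a + t *: x) = x.
  by rewrite scalerDr addKr scalerA mulVf ?scale1r// gt_eqF.
(* The reverse inequality is the first one applied to the inverse map, of ratio [1/t]. *)
have {1}-> : A = (fun x => - (t^-1 *: a) + t^-1 *: x) @` ((fun x => a + t *: x)%R @` A).
  apply/seteqP; split => [x Ax|_ [_ [x Ax <-] <-]].
    by exists (a + t *: x); [exists x|exact: tK].
  by rewrite (tK x).
rewrite -lee_pdivlMl// -exprVn.
by apply: lebesgue_outer_affine_le; rewrite invr_gt0.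
Qed.

Lemma lebesgue_outer_translate (a : 'rV[R]_n) A : leb ((fun x => a + x)%R @` A) = leb A.
Proof.
transitivity (leb ((fun x => a + 1 *: x)%R @` A)).
  by congr (leb _); apply: eq_imagel => x _; rewrite scale1r.
by rewrite lebesgue_outer_affine// expr1n mul1e.
Qed.

Lemma lebesgue_outer_scale (t : R) A : 0 < t ->
  leb ((fun x => t *: x)%R @` A) = ((t ^+ n)%:E * leb A)%E.
Proof.
move=> t0; rewrite -(lebesgue_outer_affine 0)//.
by congr (leb _); apply: eq_imagel => x _; rewrite add0r.
Qed.

Lemma lebesgue_outer_opp_le A : (leb (-%R%R @` A) <= leb A)%E.
Proof.
rewrite -[leRHS]mul1e; apply: lebesgue_outer_image_le => // I.
apply: (@le_trans _ _ (leb (open_box (- I.2, - I.1)))).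
  apply: le_outer_measure => _ [x Ix <-] i /=; have /andP[xi1 xi2] := Ix i.
  by rewrite !mxE !ltrN2 xi1 xi2.
apply: le_trans (lebesgue_outer_open_box _) _.
rewrite lee_fin /box_volume mul1r le_eqVlt; apply/orP; left; apply/eqP.
by apply: eq_bigr => i _; rewrite !mxE/= opprK addrC.
Qed.

Lemma lebesgue_outer_opp A : leb (-%R @` A) = leb A.
Proof.
apply/eqP; rewrite eq_le lebesgue_outer_opp_le/=.
rewrite -[A in leLHS](_ : -%R @` (-%R @` A) = A) ?lebesgue_outer_opp_le//.
apply/seteqP; split => [_ [_ [x Ax <-] <-]|x Ax].
  by rewrite opprK.
by exists (- x); [exists x|rewrite opprK].
Qed.

End lebesgue_outer_basics.

(** * Measurability and outer regularity *)

Section lebesgue_measurability.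
Context (R : realType) (n : nat).
Implicit Types (A E : set 'rV[R]_n) (I : 'rV[R]_n * 'rV[R]_n) (x y : 'rV[R]_n).

Local Notation leb := (lebesgue_outer_measure R n).
Local Notation LT := (lebesgue_type R n).

Lemma coord_le_norm x i : `|x ord0 i| <= `|x|.
Proof.
by rewrite [leRHS]mx_normrE; apply: (le_bigmax _ (fun p => `|x p.1 p.2|) (ord0, i)).
Qed.

Lemma norm_lt_coord x (e : R) : 0 < e ->
  (forall i, `|x ord0 i| < e) -> `|x| < e.
Proof.
move=> e0 xe; rewrite [ltLHS]mx_normrE; apply/bigmax_ltP; split => // -[i j] _ /=.
by rewrite (ord1 i).
Qed.

Lemma open_normP A : open A <->
  forall x, A x -> exists2 e : R, 0 < e & forall y, `|y - x| < e -> A y.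
Proof.
rewrite openE; split => [oA x /oA|oA x /oA[e e0 eA]].
  rewrite /interior => /nbhs_ballP[e /= e0 eA]; exists e => // y yx.
  by apply: eA; rewrite -ball_normE /= distrC.
by apply/nbhs_ballP; exists e => // y; rewrite -ball_normE /= distrC; exact: eA.
Qed.

(** The part of the hyperplane in a cube of half side [k] lies in a box of thickness [2 d] and
    volume [e V / (V + 1) <= e]. Dividing by [V + 1] allows for [V = 0]. *)
Lemma lebesgue_outer_hyperplane (i : 'I_n) (a : R) :
  leb [set x | x ord0 i = a] = 0%E.
Proof.
pose Hk (k : nat) := [set x : 'rV[R]_n | x ord0 i = a /\ forall j, `|x ord0 j| < k%:R].
apply/eqP; rewrite eq_le outer_measure_ge0 andbT.
apply: (@le_trans _ _ (leb (\bigcup_k Hk k))).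
  apply: le_outer_measure => x /= xa.
  have /archi_boundP := normr_ge0 x; set k := Num.bound _ => kx.
  exists k => //; split => // j.
  exact: le_lt_trans (coord_le_norm _ _) kx.
apply: le_trans (outer_measure_sigma_subadditive _ _) _.
rewrite eseries0// => k _ _; apply/eqP; rewrite eq_le outer_measure_ge0 andbT.
pose V : R := \prod_(j < n | j != i) (k%:R + k%:R).
have V0 : 0 <= V by apply: prodr_ge0 => j _; rewrite addr_ge0.
apply/lee_addgt0Pr => e e0; rewrite add0e.
have V1 : 0 < V + 1 by rewrite ltr_wpDl.
pose d := e / (V + 1) / 2.
have d0 : 0 < d by rewrite !divr_gt0.
pose J : 'rV[R]_n * 'rV[R]_n :=
  (\row_j (if j == i then a - d else - k%:R), \row_j (if j == i then a + d else k%:R)).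
apply: (@le_trans _ _ (leb (open_box J))).
  apply: le_outer_measure => x [xa xk] j; rewrite !mxE.
  case: eqP => [->|_]; first by rewrite xa ltrBlDr ltrDl d0.
  by rewrite -ltr_norml.
apply: le_trans (lebesgue_outer_open_box _) _.
rewrite lee_fin /box_volume (bigD1 i)//= !mxE eqxx.
rewrite (eq_bigr (fun=> k%:R + k%:R)); last first.
  by move=> j ji; rewrite !mxE (negbTE ji) opprK; apply/max_idPr; rewrite addr_ge0.
rewrite -/V (_ : a + d - (a - d) = d *+ 2); last by rewrite mulr2n; ring.
have -> : Num.max 0 (d *+ 2) = e / (V + 1).
  have -> : d *+ 2 = e / (V + 1).
    by rewrite mulr2n [RHS]splitr.
  by apply/max_idPr; rewrite divr_ge0// ltW.
rewrite mulrAC ler_pdivrMr// ler_pM2l//.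
by rewrite lerDl.
Qed.

(** By Caratheodory's criterion it suffices to cut each box of a cover of [X] along the hyperplane:
    the volumes of [lo I] and [hi I] add up to at most that of [I]. The open boxes miss the cut
    itself, which is null. *)
Lemma measurable_half_space (i : 'I_n) (a : R) :
  measurable ([set x | x ord0 i < a] : set LT).
Proof.
pose H := [set x : 'rV[R]_n | x ord0 i < a].
pose H' := [set x : 'rV[R]_n | x ord0 i > a].
pose H0 := [set x : 'rV[R]_n | x ord0 i = a].
rewrite -/H; apply: le_caratheodory_measurable => X.
apply: le_ereal_inf_tmp => _ [C [cC XC] <-].
pose lo I : 'rV[R]_n * 'rV[R]_n :=
  (I.1, \row_j (if j == i then Num.min (I.2 ord0 i) a else I.2 ord0 j)).
pose hi I : 'rV[R]_n * 'rV[R]_n :=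
  (\row_j (if j == i then Num.max (I.1 ord0 i) a else I.1 ord0 j), I.2).
have leL : (leb (X `&` H) <= \esum_(I in C) (box_volume (lo I))%:E)%E.
  apply: le_trans (outer_measure_le_esum (F := fun I => open_box (lo I)) cC _) _.
    move=> x [/XC[I CI Ix] xa]; exists I => // j; rewrite !mxE.
    by have /andP[-> Ixj] := Ix j; case: eqP => //= ji; rewrite -ji lt_min Ixj ji.
  by apply: le_esum => I _; exact: lebesgue_outer_open_box.
have leH : (leb (X `&` ~` H) <= \esum_(I in C) (box_volume (hi I))%:E)%E.
  apply: (@le_trans _ _ (leb ((X `&` H') `|` H0))).
    apply: le_outer_measure => x [Xx /=]; case: (ltgtP (x ord0 i) a) => // xa _; first by left.
    by right.
  apply: le_trans (outer_measureU2 _ _ _) _.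
  rewrite [X in (_ + X)%E]lebesgue_outer_hyperplane adde0.
  apply: le_trans (outer_measure_le_esum (F := fun I => open_box (hi I)) cC _) _.
    move=> x [/XC[I CI Ix] xa]; exists I => // j; rewrite !mxE.
    have /andP[Ixj ->] := Ix j; rewrite andbT.
    by case: eqP => //= ji; rewrite -ji gt_max Ixj ji.
  by apply: le_esum => I _; exact: lebesgue_outer_open_box.
apply: le_trans (leeD leL leH) _.
rewrite -esumD; try by move=> I _; exact: box_volume_ge0.
apply: le_esum => I _; rewrite -EFinD lee_fin /box_volume.
rewrite (bigD1 i)//= [X in _ + X <= _](bigD1 i)//= [leRHS](bigD1 i)//=.
set P := \prod_(_ < _ | _) _; set P1 := \prod_(_ < _ | _) _; set P2 := \prod_(_ < _ | _) _.
have -> : P = P2.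
  by apply: eq_bigr => j ji; rewrite !mxE (negbTE ji).
have -> : P1 = P2.
  by apply: eq_bigr => j ji; rewrite !mxE (negbTE ji).
rewrite -mulrDl; apply: ler_wpM2r.
  by apply: prodr_ge0 => j _; rewrite le_max lexx.
rewrite !mxE eqxx; move: (I.1 ord0 i) (I.2 ord0 i) => l u.
rewrite /Num.max /Num.min; do ?case: ifPn; rewrite -?leNgt; lra.
Qed.

Lemma measurable_half_space_gt (i : 'I_n) (a : R) :
  measurable ([set x | a < x ord0 i] : set LT).
Proof.
have E : [set x : 'rV[R]_n | a < x ord0 i] =
    \bigcup_k ~` [set x : 'rV[R]_n | x ord0 i < a + k.+1%:R^-1].
  apply/seteqP; split => [x /= ax|x [k _ /= /negP]]; last first.
    by rewrite -leNgt; apply: lt_le_trans; rewrite ltrDl.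
  have [k] := ltr_add_invr ax.
  by exists k => //=; apply/negP; rewrite -leNgt ltW.
rewrite [X in measurable X]E; apply: bigcup_measurable => k _; apply: measurableC.
exact: measurable_half_space.
Qed.

Lemma measurable_open_box I : measurable (open_box I : set LT).
Proof.
have E : open_box I = \bigcap_(i in [set: 'I_n])
   ([set x : 'rV[R]_n | I.1 ord0 i < x ord0 i] `&` [set x : 'rV[R]_n | x ord0 i < I.2 ord0 i]).
  apply/seteqP; split => [x Ix i _|x Ix i]; first by have /andP[] := Ix i.
  by have [] := Ix i Logic.I => /= -> ->.
rewrite [X in measurable X]E; apply: fin_bigcap_measurable => // i _.
by apply: measurableI; [exact: measurable_half_space_gt|exact: measurable_half_space].
Qed.

Lemma rat_box_nbhs A x : open A -> A x -> exists q : 'rV[rat]_n * 'rV[rat]_n,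
  let J := (map_mx (@ratr R) q.1, map_mx (@ratr R) q.2) in
  open_box J x /\ open_box J `<=` A.
Proof.
move=> /open_normP oA /oA[e e0 eA].
have : forall i, exists p : rat * rat, [/\ x ord0 i - e < ratr p.1 < x ord0 i &
    x ord0 i < ratr p.2 < x ord0 i + e].
  move=> i.
  have [|p] := @rat_in_itvoo R (x ord0 i - e) (x ord0 i); first by rewrite ltrBlDr ltrDl.
  have [|r] := @rat_in_itvoo R (x ord0 i) (x ord0 i + e); first by rewrite ltrDl.
  by rewrite !in_itv/= => rx px; exists (p, r).
move=> /choice[p px].
exists (\row_i (p i).1, \row_i (p i).2) => /=; split.
  by move=> i; rewrite !mxE; have [/andP[_ ->] /andP[-> _]] := px i.
move=> y yJ; apply: eA; apply: norm_lt_coord => // i.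
have := yJ i; have [/andP[a b] /andP[c d]] := px i; rewrite !mxE => /andP[f g].
by rewrite ltr_norml; apply/andP; split; lra.
Qed.

Lemma open_lebesgue_measurable A : open A -> measurable (A : set LT).
Proof.
move=> oA.
pose box (q : 'rV[rat]_n * 'rV[rat]_n) :=
  open_box (map_mx (@ratr R) q.1, map_mx (@ratr R) q.2).
have E : A = \bigcup_q (if `[< box q `<=` A >] then box q else set0).
  apply/seteqP; split => [x Ax|x [q _]]; last by case: asboolP => // qA /qA.
  by have [q [qx qA]] := rat_box_nbhs oA Ax; exists q => //; rewrite asboolT.
rewrite [X in measurable X]E; apply: countable_bigcupT_measurable; first exact: countableP.
by move=> q; case: ifP => _; [exact: measurable_open_box|exact: measurable0].
Qed.

Lemma closed_lebesgue_measurable A : closed A -> measurable (A : set LT).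
Proof.
by move=> cA; rewrite -[A]setCK; apply/measurableC/open_lebesgue_measurable/closed_openC.
Qed.

Lemma open_open_box I : open (open_box I).
Proof.
apply/open_normP => x Ix.
have : forall i, exists e : R, 0 < e /\
    forall z : R, `|z - x ord0 i| < e -> I.1 ord0 i < z < I.2 ord0 i.
  move=> i; have /andP[Ix1 Ix2] := Ix i.
  exists (Num.min (x ord0 i - I.1 ord0 i) (I.2 ord0 i - x ord0 i)); split.
    by rewrite lt_min !subr_gt0 Ix1.
  by move=> z; rewrite lt_min !ltr_norml => /andP[] /andP[? ?] /andP[? ?]; apply/andP; split; lra.
move=> /choice[e eI].
pose d := \big[Num.min/1]_i e i.
have d0 : 0 < d by apply: lt_bigmin => // i _; have [] := eI i.
exists d => // y yx i; have [_] := eI i; apply.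
have := coord_le_norm (y - x) i; rewrite !mxE => /le_lt_trans; apply.
by apply: lt_le_trans yx _; exact: bigmin_le.
Qed.

Definition centered_cube (r : R) : set 'rV[R]_n := [set x | `|x| < r].

Lemma lebesgue_outer_centered_cube r : (leb (centered_cube r) < +oo)%E.
Proof.
apply: (@le_lt_trans _ _ (leb (open_box (\row__ (- r), \row__ r)))).
  apply: le_outer_measure => x xr i; rewrite !mxE -ltr_norml.
  exact: le_lt_trans (coord_le_norm _ _) xr.
by apply: le_lt_trans (lebesgue_outer_open_box _) _; rewrite ltry.
Qed.

Lemma bounded_setP A : bounded_set A -> exists2 r : R, 0 < r & A `<=` centered_cube r.
Proof.
move=> [M [_ MA]]; exists (Num.max (M + 2) 1); first by rewrite lt_max ltr01 orbT.
move=> x Ax; rewrite /centered_cube /= lt_max; apply/orP; left.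
have /MA/(_ _ Ax) : M < M + 1 by rewrite ltrDl.
by move=> /le_lt_trans; apply; rewrite ltrD2l ltr1n.
Qed.

Lemma bounded_lebesgue_lty A : bounded_set A -> (leb A < +oo)%E.
Proof.
move=> /bounded_setP[r _ Ar].
by apply: le_lt_trans (lebesgue_outer_centered_cube r); exact: le_outer_measure.
Qed.

Lemma lebesgue_outer_regular A (e : R) : 0 < e -> (leb A < +oo)%E ->
  exists O : set 'rV[R]_n, [/\ open O, A `<=` O & (leb O <= leb A + e%:E)%E].
Proof.
move=> e0 Afin.
have Afn : leb A \is a fin_num by rewrite ge0_fin_numE.
have [_ [C [cC AC] <-] lte] := lb_ereal_inf_adherent e0 Afn.
exists (\bigcup_(I in C) open_box I); split => //.
  by apply: bigcup_open => I _; exact: open_open_box.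
apply: le_trans (ltW lte).
apply: le_trans (outer_measure_le_esum (F := fun I => open_box I) cC _) _ => //.
by apply: le_esum => I _; exact: lebesgue_outer_open_box.
Qed.

End lebesgue_measurability.

(** * Translation averages *)

Section translation_average.
Context (R : realType) (n : nat).
Implicit Types (A W : set 'rV[R]_n) (x t : 'rV[R]_n).

Local Notation leb := (lebesgue_outer_measure R n).
Local Notation LT := (lebesgue_type R n).
Local Notation mu := (lebesgue R n).

Definition translate t A : set 'rV[R]_n := [set x | A (x - t)].

Lemma translateE t A : translate t A = (fun x => t + x) @` A.
Proof.
apply/seteqP; split => [x Ax|_ [x Ax <-]]; last by rewrite /translate /= addrC addKr.
by exists (x - t) => //; rewrite addrC subrK.
Qed.

Lemma lebesgue_translate t A : leb (translate t A) = leb A.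
Proof. by rewrite translateE lebesgue_outer_translate. Qed.

Lemma open_translate t A : open A -> open (translate t A).
Proof.
move=> /open_normP oA; apply/open_normP => x /oA[e e0 eA].
by exists e => // y yx; apply: eA; rewrite opprB addrA subrK.
Qed.

Lemma open_norm_ball t (r : R) : open [set x | `|x - t| < r].
Proof.
apply/open_normP => x /= xr; exists (r - `|x - t|); first by rewrite subr_gt0.
move=> y; rewrite ltrBrDr => /(le_lt_trans _); apply.
by rewrite (le_trans _ (ler_normD _ _))// addrA subrK.
Qed.

Lemma open_centered_cube (r : R) : open (@centered_cube R n r).
Proof.
have -> : @centered_cube R n r = [set x | `|x - 0| < r].
  by apply/funext => x; rewrite /centered_cube /= subr0.
exact: open_norm_ball.
Qed.

Lemma lebesgue_sigma_finite : sigma_finite setT mu.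
Proof.
exists (fun k => @centered_cube R n k%:R).
  apply/seteqP; split => // x _; exists (Num.bound `|x|) => //.
  exact: archi_boundP.
move=> k; split; last exact: lebesgue_outer_centered_cube.
exact/open_lebesgue_measurable/open_centered_cube.
Qed.

(** A copy of [mu] that receives the sigma-finite structure needed for Tonelli's theorem. *)
Let smu : set LT -> \bar R := mu.

HB.instance Definition _ := Measure.copy smu (Measure.sort mu).

HB.instance Definition _ :=
  @Measure_isSigmaFinite.Build _ LT R smu lebesgue_sigma_finite.

(** The product sigma-algebra is generated by rectangles, so this open set is written as a countable
    union of products of rational boxes. *)
Lemma measurable_difference_preimage W : open W ->
  measurable ([set z | W (z.1 - z.2)] : set (LT * LT)%type).
Proof.
move=> oW.
pose box (q : 'rV[rat]_n * 'rV[rat]_n) : set LT :=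
  open_box (map_mx (@ratr R) q.1, map_mx (@ratr R) q.2).
have E : [set z | W (z.1 - z.2)] =
  \bigcup_q (if `[< box q.1 `*` box q.2 `<=` [set z | W (z.1 - z.2)] >]
    then box q.1 `*` box q.2 else set0).
  apply/seteqP; split => [[x t] Wxt|z [q _]]; last first.
    by case: asboolP => // qW /qW.
  have /open_normP/(_ _ Wxt)[e e0 eW] := oW.
  have e20 : 0 < e / 2 by rewrite divr_gt0.
  have [|p [px pe]] := @rat_box_nbhs R n _ x (@open_norm_ball x (e / 2)).
    by rewrite /= subrr normr0.
  have [|q [qt qe]] := @rat_box_nbhs R n _ t (@open_norm_ball t (e / 2)).
    by rewrite /= subrr normr0.
  exists (p, q) => //; rewrite asboolT//= => -[y s] [/= /pe ye /qe se].
  apply: eW; rewrite (_ : y - s - _ = (y - x) - (s - t)); last first.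
    by rewrite /= !opprB addrACA [RHS]addrACA [- x + _]addrC.
  by rewrite (le_lt_trans (ler_normB _ _))// [ltRHS]splitr ltrD.
rewrite [X in measurable X]E; apply: countable_bigcupT_measurable.
  exact: countableP.
move=> q; case: ifP => _; last exact: measurable0.
by apply: measurableX; exact: measurable_open_box.
Qed.

Lemma integral_indic_scaled (D A : set LT) (k : R) : 0 <= k ->
  measurable D -> measurable A ->
  (\int[mu]_(x in D) (k%:E * (\1_A x)%:E) = k%:E * leb (A `&` D))%E.
Proof.
move=> k0 mD mA.
have mA1 : measurable_fun D (fun x => (\1_A x)%:E : \bar R).
  by apply/measurable_EFinP; exact: measurable_indic.
have A0 : forall x : LT, D x -> (0 <= (\1_A x)%:E :> \bar R)%E.
  by move=> x _; rewrite lee_fin.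
have := @ge0_integralZl_EFin _ LT R mu D mD _ A0 mA1 k k0.
by move=> ->; rewrite integral_indic.
Qed.

(** Tonelli's theorem for the set [X] of pairs [(x, t)] with [x] in [A] and [x - t] in [W]:
    integrating first in [t] gives [|A| |W|]; integrating first in [x] gives the integral of
    [|A /\ (t + W)|], whose integrand vanishes unless [|t| < 2 r]. *)
Lemma lebesgue_translate_average A W (r c : R) : 0 <= c ->
  measurable (A : set LT) -> open W ->
  A `<=` centered_cube r -> W `<=` centered_cube r ->
  (forall t, `|t| < r + r -> (leb (A `&` translate t W) <= c%:E)%E) ->
  (leb A * leb W <= c%:E * leb (@centered_cube R n (r + r)%R))%E.
Proof.
move=> c0 mA oW Ar Wr Hc.
pose X : set (LT * LT)%type := (A `*` setT) `&` [set z | W (z.1 - z.2)].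
have mX : measurable X.
  apply: measurableI; last exact: measurable_difference_preimage.
  by apply: measurableX.
have mcube : measurable (@centered_cube R n (r + r) : set LT).
  exact/open_lebesgue_measurable/open_centered_cube.
have Wfin : leb W \is a fin_num.
  rewrite ge0_fin_numE ?outer_measure_ge0//.
  by apply: le_lt_trans (lebesgue_outer_centered_cube n r); exact: le_outer_measure.
have EL : (\int[mu]_x \int[mu]_t (\1_X (x, t))%:E = leb A * leb W)%E.
  transitivity (\int[mu]_x ((fine (leb W))%:E * (\1_A x)%:E))%E.
    apply: eq_integral => x _.
    have [Ax|nAx] := pselect (A x); last first.
      rewrite indicE memNset// mule0; apply: integral0_eq => t _.
      by rewrite indicE memNset// => -[[]].
    rewrite indicE mem_set// mule1 fineK//.
    pose Y : set LT := [set t | W (x - t)].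
    have EY : Y = -%R @` translate (- x) W.
      apply/seteqP; split => [t Wxt|_ [t Wt <-]].
        by exists (- t); rewrite ?opprK// /translate /= opprK addrC.
      by rewrite /Y /= opprK addrC; move: Wt; rewrite /translate /= opprK.
    have mY : measurable Y.
      apply: open_lebesgue_measurable; apply/open_normP => t Wxt.
      have /open_normP/(_ _ Wxt)[e e0 eW] := oW.
      exists e => // s st; apply: eW.
      by rewrite (_ : x - s - _ = t - s) 1?distrC// opprB addrC addrA subrK.
    transitivity (\int[mu]_t (\1_Y t)%:E)%E.
      by apply: eq_integral => t _; rewrite !indicE; congr (_%:R)%:E; congr nat_of_bool; apply/idP/idP;
        rewrite !inE => // -[].
    rewrite integral_indic// setIT.
    transitivity (leb Y) => //.
    by rewrite EY lebesgue_outer_opp lebesgue_translate.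
  have fW0 : 0 <= fine (leb W) by exact/fine_ge0/outer_measure_ge0.
  by rewrite (integral_indic_scaled fW0 measurableT mA) setIT fineK// muleC.
have ER : (\int[mu]_t \int[mu]_x (\1_X (x, t))%:E = \int[mu]_t leb (A `&` translate t W))%E.
  apply: eq_integral => t _.
  transitivity (\int[mu]_x (\1_(A `&` translate t W) x)%:E)%E.
    by apply: eq_integral => x _; rewrite !indicE; congr (_%:R)%:E; congr nat_of_bool; apply/idP/idP;
       rewrite !inE => -[] // [].
  rewrite integral_indic// ?setIT//; apply: measurableI => //.
  exact/open_lebesgue_measurable/open_translate.
have E : (\int[mu]_x \int[mu]_t (\1_X (x, t))%:E = \int[mu]_t \int[mu]_x (\1_X (x, t))%:E)%E.
  apply: (@fubini_tonelli _ _ LT LT R smu smu (fun z => (\1_X z)%:E)).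
    by apply/measurable_EFinP; exact: measurable_indic.
  by move=> z; rewrite lee_fin.
rewrite -EL E ER {E EL ER Wfin}.
have <- : (\int[mu]_(t in setT) (c%:E * (\1_(@centered_cube R n (r + r)) t)%:E) =
   c%:E * leb (@centered_cube R n (r + r)%R))%E.
  by rewrite integral_indic_scaled// setIT.
apply: ge0_le_integral.
- exact: measurableT.
- by move=> t _; exact: outer_measure_ge0.
- rewrite (_ : (fun t => _) = mu \o ysection X); first exact: (@measurable_fun_ysection _ _ _ _ _ smu).
  apply/funext => t /=; rewrite -[RHS]/(leb _); congr (leb _).
  by apply/seteqP; split => x; rewrite /ysection /= inE => -[] // [].
- apply: measurable_funeM.
  by apply/measurable_EFinP; exact: measurable_indic.
move=> t _; rewrite indicE.
have [tr|tr] := boolP (t \in _).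
  by rewrite mule1; apply: Hc; move: tr; rewrite inE.
rewrite mule0 (_ : _ `&` _ = set0) ?outer_measure0//.
apply/seteqP; split => // x [/Ar Ax /Wr Wxt]; move/negP: tr; apply.
rewrite inE /centered_cube/=.
rewrite (_ : t = x - (x - t)); last by rewrite opprB addrC subrK.
by rewrite (le_lt_trans (ler_normB _ _))// ltrD.
Qed.

End translation_average.

(** * Halos *)

Section halo.
Context (R : realType) (n : nat).
Implicit Types (A E S V W : set 'rV[R]_n) (x y t : 'rV[R]_n) (l r s : R).
Implicit Types (F : set (set 'rV[R]_n)).

Local Notation leb := (lebesgue_outer_measure R n).
Local Notation LT := (lebesgue_type R n).
Local Notation mu := (lebesgue R n).
Local Notation cube := (@centered_cube R n).

Definition dilate s A : set 'rV[R]_n := [set x | A (s^-1 *: x)].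

Definition reflect A : set 'rV[R]_n := [set x | A (- x)].

Lemma lebesgue_dilate s A : 0 < s -> leb (dilate s A) = ((s ^+ n)%:E * leb A)%E.
Proof.
move=> s0; rewrite -lebesgue_outer_scale//; congr (leb _).
apply/seteqP; split => [x Ax|_ [x Ax <-]].
  by exists (s^-1 *: x) => //; rewrite scalerA mulfV ?scale1r// gt_eqF.
by rewrite /dilate /= scalerA mulVf ?scale1r// gt_eqF.
Qed.

Lemma lebesgue_reflect A : leb (reflect A) = leb A.
Proof.
rewrite -[RHS]lebesgue_outer_opp; congr (leb _).
apply/seteqP; split => [x Ax|_ [x Ax <-]]; first by exists (- x); rewrite ?opprK.
by rewrite /reflect /= opprK.
Qed.

Lemma reflectK : involutive reflect.
Proof. by move=> A; apply/funext => x; rewrite /reflect /= opprK. Qed.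

Lemma translateK t : cancel (@translate R n t) (@translate R n (- t)).
Proof. by move=> A; apply/funext => x; rewrite /translate /= opprK addrK. Qed.

Lemma translateD t x A : translate (t + x) A = translate t (translate x A).
Proof. by apply/funext => y; rewrite /translate /= opprD addrA. Qed.

Lemma measurable_translate t A :
  measurable (A : set LT) -> measurable (translate t A : set LT).
Proof.
move=> mA; apply: le_caratheodory_measurable => X.
rewrite -(lebesgue_translate (- t)) -[X in (_ + X)%E](lebesgue_translate (- t)).
rewrite -[leRHS](lebesgue_translate (- t)).
have -> : translate (- t) (X `&` translate t A) = translate (- t) X `&` A.
  by rewrite -[A in RHS](translateK t).
have -> : translate (- t) (X `&` ~` translate t A) = translate (- t) X `&` ~` A.
  by rewrite -[A in RHS](translateK t).
by rewrite -mA.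
Qed.

Lemma measurable_reflect A :
  measurable (A : set LT) -> measurable (reflect A : set LT).
Proof.
move=> mA; apply: le_caratheodory_measurable => X.
rewrite -lebesgue_reflect -[X in (_ + X)%E]lebesgue_reflect -[leRHS]lebesgue_reflect.
have -> : reflect (X `&` reflect A) = reflect X `&` A by rewrite -[A in RHS]reflectK.
have -> : reflect (X `&` ~` reflect A) = reflect X `&` ~` A.
  by rewrite -[A in RHS]reflectK.
by rewrite -mA.
Qed.

Lemma open_reflect A : open A -> open (reflect A).
Proof.
move=> /open_normP oA; apply/open_normP => x /oA[e e0 eA]; exists e => // y yx.
by apply: eA; rewrite -opprD normrN.
Qed.

Lemma open_dilate s A : 0 < s -> open A -> open (dilate s A).
Proof.
move=> s0 /open_normP oA; apply/open_normP => x /oA[e e0 eA].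
exists (s * e); first by rewrite mulr_gt0.
move=> y yx; apply: eA; rewrite -scalerBr normrZ gtr0_norm ?invr_gt0//.
by rewrite mulrC ltr_pdivrMr// mulrC.
Qed.

Lemma nondecreasing_measure_gt (G : nat -> set 'rV[R]_n) (a : \bar R) :
  (forall k, measurable (G k : set LT)) -> (forall k, G k `<=` G k.+1) ->
  (a < leb (\bigcup_k G k))%E -> exists k, (a < leb (G k))%E.
Proof.
move=> mG ndG aG; apply: contrapT => /forallNP aGk; move: aG; apply/negP.
rewrite -leNgt.
have cG := @nondecreasing_cvg_mu _ LT R mu G mG (bigcupT_measurable _ mG) _.
have {}cG : (leb \o G) k @[k --> \oo] --> leb (\bigcup_k G k).
  by apply: cG; apply/nondecreasing_seqP => k; apply/subsetPset; exact: ndG.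
move/cvg_lim : (cG) => <-//; apply: lime_le; first by apply/cvg_ex; eexists; exact: cG.
by apply: nearW => k; rewrite leNgt; apply/negP; exact: aGk.
Qed.

(* If B x = x + F for all x, this is the set where the maximal function of the
   indicator of E exceeds l. *)
Definition halo F l E : set 'rV[R]_n :=
  [set x | exists2 S, F S & (l%:E * leb S < leb (E `&` translate x S))%E].

Lemma halo_sub F F' l E E' : F `<=` F' -> E `<=` E' -> halo F l E `<=` halo F' l E'.
Proof.
move=> FF' EE' x [S FS lS]; exists S; first exact: FF'.
by apply: lt_le_trans lS _; apply: le_outer_measure; exact: setSI.
Qed.

Lemma lebesgue_translateI t x E S :
  leb (translate t E `&` translate x S) = leb (E `&` translate (x - t) S).
Proof.
rewrite -[LHS](lebesgue_translate (- t)); congr (leb _).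
apply/funext => y; rewrite /translate /= opprK addrK.
by rewrite opprB addrA.
Qed.

Lemma halo_translate F l t E : halo F l (translate t E) = translate t (halo F l E).
Proof.
by apply/seteqP; split => x [S FS lS]; exists S => //; move: lS;
  rewrite lebesgue_translateI.
Qed.

Lemma lebesgue_dilateI s x E S : 0 < s ->
  leb (dilate s E `&` translate x (dilate s S)) =
  ((s ^+ n)%:E * leb (E `&` translate (s^-1 *: x) S))%E.
Proof.
move=> s0; rewrite -lebesgue_dilate//; congr (leb _).
by apply/funext => y; rewrite /dilate /translate /= scalerBr.
Qed.

Lemma lebesgue_reflectI x E S :
  leb (reflect E `&` translate x (reflect S)) = leb (E `&` translate (- x) S).
Proof.
rewrite -[LHS]lebesgue_reflect; congr (leb _).
apply/funext => y; by rewrite /reflect /translate /= !opprD !opprK.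
Qed.

Lemma halo_reflect F l E :
  halo (reflect @` F) l (reflect E) = reflect (halo F l E).
Proof.
apply/seteqP; split => x.
  move=> [_ [S FS <-] lS]; exists S => //.
  by rewrite lebesgue_reflect lebesgue_reflectI in lS.
move=> [S FS lS]; exists (reflect S); first by exists S.
by rewrite lebesgue_reflect lebesgue_reflectI.
Qed.

Lemma halo_dilate F l s E : 0 < s ->
  dilate s (halo F l E) `<=` halo (dilate s @` F) l (dilate s E).
Proof.
move=> s0 x [S FS lS]; exists (dilate s S); first by exists S.
rewrite lebesgue_dilateI// lebesgue_dilate// muleCA.
by rewrite lte_pmul2l// ?lte_fin exprn_gt0.
Qed.

(** [E] is the increasing union of the closed sets [G k] of points at distance at least [1/(k+1)]
    from its complement. The strict inequality at [x] already holds for some [G k], and a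
    translation by less than [1/(k+1)] keeps [G k] inside [E]. *)
Lemma open_halo F l E : (forall S, F S -> measurable (S : set LT)) ->
  open E -> open (halo F l E).
Proof.
move=> mF oE; apply/open_normP => x [S FS lS].
pose G k := [set y | forall z, `|z - y| < k.+1%:R^-1 -> E z].
have GE : E = \bigcup_k G k.
  apply/seteqP; split => [y Ey|y [k _ Gy]]; last by apply: Gy; rewrite subrr normr0.
  have /open_normP/(_ _ Ey)[e e0 eE] := oE.
  have [k] := ltr_add_invr e0; rewrite add0r => ke.
  by exists k => // z /lt_trans/(_ ke)/eE.
have cG k : closed (G k).
  rewrite -[G k]setCK; apply: open_closedC; apply/open_normP => y /existsNP[z /not_implyP[zy nEz]].
  exists (k.+1%:R^-1 - `|z - y|); first by rewrite subr_gt0.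
  move=> w wy Gw; apply: nEz; apply: Gw.
  rewrite (_ : z - w = z - y - (w - y)); last by rewrite opprB addrA subrK.
  by rewrite (le_lt_trans (ler_normB _ _))// -ltrBrDl.
have mS : measurable (translate x S : set LT) by exact/measurable_translate/mF.
have [k lk] : exists k, (l%:E * leb S < leb (G k `&` translate x S))%E.
  apply: nondecreasing_measure_gt.
  - by move=> k; apply: measurableI => //; exact: closed_lebesgue_measurable.
  - move=> k y [Gy Sy]; split => // z zy; apply: Gy; apply: lt_le_trans zy _.
    by rewrite lef_pV2 ?posrE// ler_nat.
  - by rewrite -setI_bigcupl -GE.
exists k.+1%:R^-1; first by rewrite invr_gt0.
move=> y yx; exists S => //; apply: lt_le_trans lk _.
rewrite -(lebesgue_translate (y - x)); apply: le_outer_measure => z [Gz Sz]; split.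
  by apply: Gz; rewrite opprB addrC subrK.
by move: Sz; rewrite /translate /= opprB addrA addrAC addrK.
Qed.

End halo.

(** * Greedy covering of a cube by translates *)

Section greedy_cover.
Context (R : realType) (n : nat).
Implicit Types (A E S V W : set 'rV[R]_n) (x y t : 'rV[R]_n) (l r s : R).
Implicit Types (F : set (set 'rV[R]_n)) (ts : seq 'rV[R]_n).

Local Notation leb := (lebesgue_outer_measure R n).
Local Notation LT := (lebesgue_type R n).
Local Notation cube := (@centered_cube R n).

Lemma centered_cube_fin r : leb (cube r) \is a fin_num.
Proof. by rewrite ge0_fin_numE ?outer_measure_ge0// lebesgue_outer_centered_cube. Qed.

Lemma sub_centered_cube_fin A r : A `<=` cube r -> leb A \is a fin_num.
Proof.
move=> Ar; rewrite ge0_fin_numE ?outer_measure_ge0//.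
by apply: le_lt_trans (lebesgue_outer_centered_cube n r); exact: le_outer_measure.
Qed.

Definition translates ts W : set 'rV[R]_n :=
  [set x | exists2 t, t \in ts & translate t W x].

Lemma open_translates ts W : open W -> open (translates ts W).
Proof.
move=> oW; rewrite (_ : translates ts W = \bigcup_(t in [set` ts]) translate t W).
  by apply: bigcup_open => t _; exact: open_translate.
by apply/seteqP; split => [x [t ? ?]|x [t ? ?]]; exists t.
Qed.

Lemma lebesgue_translates_le ts W : (leb (translates ts W) <= (size ts)%:R%:E * leb W)%E.
Proof.
elim: ts => [|t ts IH].
  rewrite mul0e (_ : translates [::] W = set0) ?outer_measure0//.
  by apply/seteqP; split => // x [].
rewrite (_ : translates (t :: ts) W = translate t W `|` translates ts W).
  apply: le_trans (outer_measureU2 _ _ _) _.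
  rewrite /= -natr1 addrC EFinD ge0_muleDl ?lee_fin//.
  by rewrite mul1e lebesgue_translate; exact: leeD2r.
apply/seteqP; split => x.
  move=> [t']; rewrite inE => /orP[/eqP ->|t'ts] tx; first by left.
  by right; exists t'.
move=> [tx|[t' t'ts tx]]; [exists t => //|exists t' => //]; rewrite inE ?eqxx//.
by rewrite t'ts orbT.
Qed.

(** The mean of [|A /\ (t + W)|] over [cube 2] is [|A| |W| / |cube 2|]. The factor 1/2 makes the
    argument by contradiction strict: it leaves only [|A| = 0], where [t = 0] works. *)
Lemma exists_translate_large A W : measurable (A : set LT) -> open W ->
  A `<=` cube 1 -> W `<=` cube 1 -> 0 < fine (leb W) ->
  exists2 t, `|t| < 2 &
    ((fine (leb W) / (2 * fine (leb (cube 2))) * fine (leb A))%:E <=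
      leb (A `&` translate t W))%E.
Proof.
move=> mA oW A1 W1 w0; apply: contrapT => nt.
have k2 : 0 < fine (leb (cube 2)).
  apply: lt_le_trans w0 _; apply: fine_le; [exact: sub_centered_cube_fin W1|exact: centered_cube_fin|].
  by apply: le_outer_measure => x /W1 /lt_trans; apply; rewrite ltr1n.
set w := fine (leb W) in w0 nt *; set k := fine (leb (cube 2)) in k2 nt *.
set a := fine (leb A) in nt *.
have a0 : 0 <= a by exact/fine_ge0/outer_measure_ge0.
pose c := w / (2 * k) * a.
have c0 : 0 <= c by rewrite mulr_ge0// divr_ge0 ?ltW// mulr_gt0.
have small t : `|t| < 1 + 1 -> (leb (A `&` translate t W) <= c%:E)%E.
  move=> t2; apply: contrapT => /negP; rewrite -ltNge => ct; apply: nt.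
  by exists t => //; exact: ltW.
have := lebesgue_translate_average c0 mA oW A1 W1 small.
rewrite -[leb A]fineK ?(sub_centered_cube_fin A1)//.
rewrite -[leb W]fineK ?(sub_centered_cube_fin W1)//.
rewrite -[leb (cube _)]fineK ?centered_cube_fin//.
rewrite -!EFinM lee_fin -/w -/a -/k.
have -> : c * k = a * w / 2.
  rewrite /c; field.
  by rewrite gt_eqF.
move=> aw; have aw0 : a * w = 0.
  have aw0 : 0 <= a * w by exact: mulr_ge0 a0 (ltW w0).
  lra.
have {aw0}aE : a = 0 by apply/eqP; move/eqP: aw0; rewrite mulf_eq0 (gt_eqF w0) orbF.
apply: nt; exists 0; first by rewrite normr0.
by rewrite aE mulr0 outer_measure_ge0.
Qed.

(** Each new translate covers at least the fraction [|W| / (2 |cube 2|)] of what the earlier ones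
    leave uncovered, so the remainder decays geometrically. *)
Lemma greedy_translates W m : open W -> W `<=` cube 1 -> 0 < fine (leb W) ->
  exists ts, [/\ size ts = m, {in ts, forall t, `|t| < 2} &
    (leb (cube 1 `\` translates ts W) <=
     ((1 - fine (leb W) / (2 * fine (leb (cube 2)))) ^+ m * fine (leb (cube 1)))%:E)%E].
Proof.
move=> oW W1 w0; elim: m => [|m [ts [szts ts2 IH]]].
  exists [::]; split => //; rewrite expr0 mul1r fineK ?centered_cube_fin//.
  by apply: le_outer_measure; exact: subDsetl.
pose A := cube 1 `\` translates ts W.
have A1 : A `<=` cube 1 by exact: subDsetl.
have mA : measurable (A : set LT).
  apply: measurableD; first exact/open_lebesgue_measurable/open_centered_cube.
  exact/open_lebesgue_measurable/open_translates.
have [t t2 At] := exists_translate_large mA oW A1 W1 w0.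
exists (t :: ts); split; first by rewrite /= szts.
  by move=> t'; rewrite inE => /orP[/eqP ->//|]; exact: ts2.
have -> : cube 1 `\` translates (t :: ts) W = A `&` ~` translate t W.
  apply/seteqP; split => x.
    move=> [x1 nx]; split; last by move=> tx; apply: nx; exists t; rewrite ?inE ?eqxx.
    by split => // -[t' t'ts t'x]; apply: nx; exists t'; rewrite // inE t'ts orbT.
  move=> [[x1 nx] ntx]; split => // -[t']; rewrite inE => /orP[/eqP ->//|t'ts t'x].
  by apply: nx; exists t'.
have mt : measurable (translate t W : set LT).
  exact/open_lebesgue_measurable/open_translate.
have fA := sub_centered_cube_fin A1.
have fA1 := @sub_centered_cube_fin (A `&` translate t W) 1 (subset_trans (@subIsetl _ _ _) A1).
have fA2 := @sub_centered_cube_fin (A `&` ~` translate t W) 1 (subset_trans (@subIsetl _ _ _) A1).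
have := mt A.
rewrite -(fineK fA) -(fineK fA1) -(fineK fA2).
move=> AE'; have {AE'}AE : fine (leb A) =
    fine (leb (A `&` translate t W)) + fine (leb (A `&` ~` translate t W)).
  exact: EFin_inj AE'.
move: At; rewrite -(fineK fA1) lee_fin.
move: IH; rewrite -/A -(fineK fA) -(fineK fA2) !lee_fin.
set w := _ / _ => IH At.
have w1 : w <= 1.
  rewrite ler_pdivrMr ?mul1r; last first.
    rewrite mulr_gt0//; apply: lt_le_trans w0 _; apply: fine_le; [exact: sub_centered_cube_fin W1|exact: centered_cube_fin|].
    by apply: le_outer_measure => x /W1 /lt_trans; apply; rewrite ltr1n.
  apply: (@le_trans _ _ (fine (leb (cube 2)))).
    apply: fine_le; [exact: sub_centered_cube_fin W1|exact: centered_cube_fin|].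
    by apply: le_outer_measure => x /W1 /lt_trans; apply; rewrite ltr1n.
  by rewrite ler_peMl ?ler1n//; exact/fine_ge0/outer_measure_ge0.
apply: (@le_trans _ _ ((1 - w) * fine (leb A))); first by lra.
by rewrite exprS -mulrA ler_wpM2l// subr_ge0.
Qed.

End greedy_cover.

(** * Weak type bounds from an estimate at small scales *)

Section weak_type.
Context (R : realType) (n : nat).
Implicit Types (A E S V W : set 'rV[R]_n) (x y t : 'rV[R]_n) (l r s : R).
Implicit Types (F : set (set 'rV[R]_n)) (ts : seq 'rV[R]_n).

Local Notation leb := (lebesgue_outer_measure R n).
Local Notation LT := (lebesgue_type R n).
Local Notation cube := (@centered_cube R n).

(** The inductive step is [(1 - q) (1 + (m + 1) q) <= 1 + m q]. *)
Lemma bernoulli_decay (q : R) m : 0 <= q <= 1 -> (1 - q) ^+ m * (1 + m%:R * q) <= 1.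
Proof.
move=> /andP[q0 q1]; elim: m => [|m IH]; first by rewrite expr0 mul0r addr0 mul1r.
apply: le_trans IH; rewrite exprSr -mulrA.
apply: ler_wpM2l; first by rewrite exprn_ge0// subr_ge0.
rewrite -natr1; have m0 : 0 <= m%:R :> R by [].
by nra.
Qed.

Lemma half_decay (q : R) m : 0 <= q <= 1 -> 1 < m%:R * q -> (1 - q) ^+ m < 1 / 2.
Proof.
move=> q01 mq1; have := bernoulli_decay m q01.
have : 0 <= (1 - q) ^+ m by case/andP: q01 => _ q1; rewrite exprn_ge0// subr_ge0.
move: ((1 - q) ^+ m) mq1 => z; move: (m%:R * q) => p p1 z0 zp.
rewrite ltNge; apply/negP => z2.
have : 1 / 2 * (1 + p) <= z * (1 + p) by apply: ler_wpM2r => //; lra.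
by move: (z * (1 + p)) zp => w; lra.
Qed.

(* If W were too large, few translates of it would cover more than half of the
   cube while the same translates of V would have total measure at most d. *)
Lemma lebesgue_halo_small_le F l (d : R) V W :
  open V -> open W -> V `<=` cube 1 -> W `<=` cube 1 -> W `<=` halo F l V ->
  0 < d -> 0 < fine (leb (cube 1)) ->
  (forall S, F S -> measurable (S : set LT)) ->
  (forall V', open V' -> V' `<=` cube 3 -> (leb V' <= d%:E)%E ->
    (leb (halo F l V' `&` cube 1) <= (fine (leb (cube 1)) / 2)%:E)%E) ->
  fine (leb W) <= 4 * fine (leb (cube 2)) / d * fine (leb V).
Proof.
move=> oV oW V1 W1 WV d0 k0 mF small; rewrite leNgt; apply/negP => Wbig.
have fcube1 := @centered_cube_fin R n 1; have fcube2 := @centered_cube_fin R n 2.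
have fV := sub_centered_cube_fin V1; have fW := sub_centered_cube_fin W1.
have k12 : fine (leb (cube 1)) <= fine (leb (cube 2)).
  by apply: fine_le => //; apply: le_outer_measure => x /lt_trans; apply; rewrite ltr1n.
have wk1 : fine (leb W) <= fine (leb (cube 1)) by apply: fine_le => //; exact: le_outer_measure.
have v0 : 0 <= fine (leb V) by exact/fine_ge0/outer_measure_ge0.
have w0 : 0 < fine (leb W).
  by apply: le_lt_trans Wbig; rewrite mulr_ge0// divr_ge0 ?(ltW d0)// mulr_ge0//; lra.
pose q := fine (leb W) / (2 * fine (leb (cube 2))).
have k20 : 0 < 2 * fine (leb (cube 2)) by lra.
have q0 : 0 < q by rewrite divr_gt0.
have q1 : q <= 1 by rewrite ler_pdivrMr// mul1r; lra.
have qi1 : 1 <= q^-1 by rewrite invf_ge1.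
(* More than [1/q] translates leave less than half of the cube uncovered, while [m <= 2/q] keeps the
   total measure of the translates of [V] at most [d], by the assumed lower bound on [|W|]. *)
pose m := (Num.truncn q^-1).+1.
have /andP[mq qm] : (Num.truncn q^-1)%:R <= q^-1 < m%:R.
  by apply: truncn_itv; lra.
have mq2 : m%:R <= 2 * q^-1 by rewrite /m -natr1; lra.
have [ts [szts ts2 tsW]] := greedy_translates m oW W1 w0.
have Vd : (leb (translates ts V) <= d%:E)%E.
  apply: le_trans (lebesgue_translates_le _ _) _.
  rewrite szts -(fineK fV) -EFinM lee_fin.
  apply: (@le_trans _ _ (2 * q^-1 * fine (leb V))); first exact: ler_wpM2r.
  have -> : 2 * q^-1 * fine (leb V) =
      4 * fine (leb (cube 2)) * fine (leb V) / fine (leb W).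
    by rewrite /q invf_div; ring.
  rewrite ler_pdivrMr//; move: Wbig; rewrite mulrAC ltr_pdivrMr// => /ltW.
  by rewrite mulrC [_ * d]mulrC.
have V3 : translates ts V `<=` cube 3.
  move=> x [t /ts2 t2 /V1 x1].
  have -> : x = x - t + t by rewrite subrK.
  rewrite /centered_cube/= (le_lt_trans (ler_normD _ _))//.
  by move: x1 t2; rewrite /centered_cube/=; lra.
have := small _ (@open_translates R n ts V oV) V3 Vd.
set H := halo F l _ `&` _ => leH.
have : (leb (cube 1) <= leb (cube 1 `\` translates ts W) + leb H)%E.
  apply: le_trans (outer_measureU2 _ _ _); apply: le_outer_measure => x x1.
  have [[t tts tx]|nx] := pselect (translates ts W x); last by left.
  right; split => //.
  have : halo F l (translate t V) x by rewrite halo_translate; exact: WV.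
  by apply: halo_sub => // y ty; exists t.
move=> /le_trans/(_ (leeD tsW leH)).
rewrite -(fineK fcube1) -EFinD lee_fin -/q /= => kle.
have mq1 : 1 < m%:R * q by rewrite -ltr_pdivrMr// div1r.
have : (1 - q) ^+ m < 1 / 2 by apply: half_decay => //; rewrite q1 ltW.
rewrite -(ltr_pM2r k0); move: kle.
by move: ((1 - q) ^+ m * fine _) => z; move: (fine _) => k; clear; lra.
Qed.

(** Dilation invariance brings everything to the unit scale: sets and points are truncated to
    [cube N] and dilated by [s], where the hypothesis on small scales applies. The resulting
    constant does not depend on [N], and [N] tends to infinity by continuity from below. *)
Lemma halo_weak_type F l (d r : R) : 0 < d -> 0 < r -> 0 < fine (leb (cube 1)) ->
  (forall S, F S -> measurable (S : set LT)) ->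
  (forall S, F S -> exists s, S `<=` cube s) ->
  (forall S s, 0 < s -> F S -> F (dilate s S)) ->
  (forall V, open V -> V `<=` cube 3 -> (leb V <= d%:E)%E ->
    (leb (halo (F `&` [set S | S `<=` cube r]) l V `&` cube 1) <=
      (fine (leb (cube 1)) / 2)%:E)%E) ->
  exists2 C : R, 0 < C & forall E, open E -> (leb (halo F l E) <= C%:E * leb E)%E.
Proof.
move=> d0 r0 k0 mF bF sF small.
have fcube1 := @centered_cube_fin R n 1; have fcube2 := @centered_cube_fin R n 2.
have k12 : fine (leb (cube 1)) <= fine (leb (cube 2)).
  by apply: fine_le => //; apply: le_outer_measure => x /lt_trans; apply; rewrite ltr1n.
pose C := 4 * fine (leb (cube 2)) / d.
have C0 : 0 < C by rewrite divr_gt0//; lra.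
exists C => // E oE.
pose F_ (N : nat) := F `&` [set S | S `<=` cube N%:R].
pose W N := halo (F_ N) l E `&` cube N%:R.
have oW N : open (W N).
  apply: openI; last exact: open_centered_cube.
  by apply: open_halo => // S [FS _]; exact: mF.
have WC N : (leb (W N) <= C%:E * leb E)%E.
  (* For [x] and [S] in [cube N], the set [x + S] lies in [cube (2 N)], so [E] may be cut there. The
     ratio [s] sends [cube (2 N)] into [cube 1] and [cube N] into [cube r]; the 1 in its denominator
     covers [N = 0]. *)
  pose E' := E `&` cube (2 * N%:R).
  pose s := Num.min 1 r / (2 * N%:R + 1).
  have N0 : 0 <= N%:R :> R by [].
  have m0 : 0 < Num.min 1 r by rewrite lt_min ltr01.
  have s0 : 0 < s by rewrite divr_gt0//; lra.
  have sN : s * (2 * N%:R) < Num.min 1 r.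
    by rewrite /s mulrAC ltr_pdivrMr ?ltr_pM2l//; lra.
  have sN1 : s * (2 * N%:R) <= 1 by rewrite (le_trans (ltW sN))// ge_min lexx.
  have sNr : s * N%:R <= r.
    apply: (@le_trans _ _ (s * (2 * N%:R))); first by rewrite ler_pM2l//; lra.
    by rewrite (le_trans (ltW sN))// ge_min lexx orbT.
  have dil_sub A (a b : R) : A `<=` cube a -> s * a <= b -> dilate s A `<=` cube b.
    move=> Aa sab x /Aa; rewrite /centered_cube /= normrZ gtr0_norm ?invr_gt0//.
    by rewrite mulrC ltr_pdivrMr// => /lt_le_trans; apply; rewrite mulrC.
  have W1 : dilate s (W N) `<=` cube 1.
    apply: (dil_sub _ N%:R); first exact: subIsetr.
    by apply: le_trans sN1; rewrite ler_pM2l//; lra.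
  have E1 : dilate s E' `<=` cube 1 by apply: dil_sub sN1; exact: subIsetr.
  have WE : dilate s (W N) `<=` halo (F `&` [set S | S `<=` cube r]) l (dilate s E').
    apply: (@subset_trans _ (dilate s (halo (F_ N) l E'))).
      move=> x [[S [FS SN] lS] xN]; exists S => //; apply: lt_le_trans lS _.
      apply: le_outer_measure => y [Ey Sy]; split => //; split => //.
      have := SN _ Sy; move: xN; rewrite /centered_cube /=.
      have := ler_normD (y - s^-1 *: x) (s^-1 *: x); rewrite subrK.
      by move: `|y| `|y - _| `|_ *: _| => a b c; lra.
    apply: subset_trans (halo_dilate _) _ => //; apply: halo_sub => //.
    move=> _ [S [FS SN] <-]; split; first exact: sF.
    exact: dil_sub sNr.
  have oE' : open E' by apply: openI => //; exact: open_centered_cube.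
  have mFr S : (F `&` [set S | S `<=` cube r]) S -> measurable (S : set LT).
    by move=> [FS _]; exact: mF.
  have := lebesgue_halo_small_le (@open_dilate R n s E' s0 oE')
    (@open_dilate R n s (W N) s0 (oW N)) E1 W1 WE d0 k0 mFr small.
  rewrite -lee_fin EFinM !fineK; [|exact: sub_centered_cube_fin E1|exact: sub_centered_cube_fin W1].
  rewrite !lebesgue_dilate// muleCA lee_pmul2l ?lte_fin ?exprn_gt0//.
  move=> /le_trans; apply; apply: lee_wpmul2l; first by rewrite lee_fin ltW.
  by apply: le_outer_measure; exact: subIsetl.
rewrite leNgt; apply/negP => lt_halo.
have [N] : exists N, (C%:E * leb E < leb (W N))%E.
  apply: nondecreasing_measure_gt.
  - by move=> N; exact: open_lebesgue_measurable.
  - move=> N x [[S [FS SN] lS] xN]; split.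
      exists S => //; split => // y /SN /lt_le_trans; apply.
      by rewrite ler_nat.
    by apply: lt_le_trans xN _; rewrite ler_nat.
  - rewrite (_ : \bigcup_k W k = halo F l E)//; apply/seteqP; split.
      by move=> x [N _ [[S [FS _] lS] _]]; exists S.
    move=> x [S FS lS]; have [r' Sr'] := bF _ FS.
    exists (Num.bound (Num.max r' `|x|)) => //.
    have m0 : 0 <= Num.max r' `|x| by rewrite le_max normr_ge0 orbT.
    have /ltW := archi_boundP m0; rewrite ge_max => /andP[r'b _].
    have := archi_boundP m0; rewrite gt_max => /andP[_ xb].
    split => //; exists S => //; split => // y /Sr' /lt_le_trans; exact.
by apply/negP; rewrite -leNgt.
Qed.

End weak_type.

(** * Weak type bounds of a density basis *)

Section density_basis.
Context (R : realType) (n : nat).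
Variable B : 'rV[R]_n -> set (set 'rV[R]_n).
Implicit Types (A E S V W : set 'rV[R]_n) (x y t : 'rV[R]_n) (l r s : R).

Local Notation leb := (lebesgue_outer_measure R n).
Local Notation LT := (lebesgue_type R n).
Local Notation mu := (lebesgue R n).
Local Notation cube := (@centered_cube R n).

Lemma basis_dilate S s : homothecy_invariant B -> 0 < s -> B 0 S -> B 0 (dilate s S).
Proof.
move=> hB s0 /(hB 0 s _ _ s0); rewrite /homothecy !(subr0, scaler0, addr0).
congr (B 0 _); apply/seteqP; split => [_ [x Sx <-]|x Sx].
  by rewrite subr0 add0r /dilate /= scalerA mulVf ?scale1r// gt_eqF.
by exists (s^-1 *: x) => //; rewrite subr0 add0r scalerA mulfV ?scale1r// gt_eqF.
Qed.

(* A translation is the product of the homothecies of ratio 2 and 1/2. *)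
Lemma basis_translate S x v : homothecy_invariant B -> B x S -> B (v + x) (translate v S).
Proof.
have two_gt0 : 0 < 2 :> R by []; have half_gt0 : 0 < 2^-1 :> R by [].
move=> hB /(hB 0 2 _ _ two_gt0)/(hB (v + v) 2^-1 _ _ half_gt0).
have E y : homothecy (v + v) 2^-1 (homothecy 0 2 y) = v + y.
  rewrite /homothecy subr0 add0r scalerBr scalerA mulVf// scale1r.
  rewrite -[in 2^-1 *: (v + v)](scale1r v) -scalerDl scalerA mulVf// scale1r.
  by rewrite addrCA addrK addrC.
rewrite E image_comp; congr (B _ _); rewrite translateE.
by apply: eq_imagel => y _; rewrite /= E.
Qed.

Lemma basis_translate0 S x : homothecy_invariant B -> B 0 S -> B x (translate x S).
Proof. by move=> hB /(basis_translate x hB); rewrite addr0. Qed.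

Lemma basis_origin S x : homothecy_invariant B -> B x S -> B 0 (translate (- x) S).
Proof. by move=> hB /(basis_translate (- x) hB); rewrite addNr. Qed.

Lemma euclidean_norm_le x r : `|x| <= r -> euclidean_norm x <= Num.sqrt n%:R * r.
Proof.
move=> xr; have r0 : 0 <= r by exact: le_trans (normr_ge0 _) xr.
rewrite /euclidean_norm -[r in leRHS](@ger0_norm R r)// -sqrtr_sqr -sqrtrM//.
rewrite ler_wsqrtr// mulr_natl -[n in _ *+ n]card_ord -sumr_const.
apply: ler_sum => i _; rewrite -real_normK ?num_real// lerXn2r ?nnegrE//.
exact: le_trans (coord_le_norm _ _) xr.
Qed.

Lemma diam_translate_le S x r : S `<=` cube r ->
  (diam (translate x S) <= (Num.sqrt n%:R * (r + r))%:E)%E.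
Proof.
move=> Sr; apply: ge_ereal_sup => _ [y Sy [z Sz <-]].
rewrite lee_fin euclidean_norm_le//.
rewrite (_ : y - z = (y - x) - (z - x)); last by rewrite opprB addrA subrK.
rewrite (le_trans (ler_normB _ _))//.
by rewrite lerD// ltW//; [exact: Sr Sy|exact: Sr Sz].
Qed.

Lemma average_indic_ge V E l : 0 <= l ->
  measurable (V : set LT) -> measurable (E : set LT) -> (0 < leb E)%E ->
  leb E \is a fin_num -> (l%:E * leb E < leb (V `&` E))%E -> (l%:E <= average \1_V E)%E.
Proof.
move=> l0 mV mE E0 fE lE; rewrite /average integral_indic//.
have e0 : 0 < fine (leb E) by apply: fine_gt0; rewrite E0 ltey_eq fE.
rewrite -[X in ((X)^-1 * _)%E](fineK fE) inver gt_eqF// muleC.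
rewrite -(@lee_pmul2r _ (fine (leb E))%:E)// -[leRHS]muleA.
rewrite -[X in (_ <= _ * X)%E]EFinM mulVf ?gt_eqF// mule1 fineK//.
exact: ltW.
Qed.

Lemma upper_derivative_ge f x l :
  (forall d, 0 < d -> exists2 E, small_sets B x d E & (l%:E <= average f E)%E) ->
  (l%:E <= upper_derivative B f x)%E.
Proof.
move=> H; apply: le_ereal_inf_tmp => _ [d /= /H[E dE lE] <-].
by apply: ereal_sup_ge; exists (average f E) => //; exists E.
Qed.

(* Otherwise there is a sequence V_i of sets of summable measures whose halos at
   scales tending to 0 are large, and at the points of the upper limit of these
   halos outside the union V of the V_i, \int 1_V has upper derivative at least
   l instead of 0. *)
Lemma density_basis_halo_small l :
  0 < l -> differentiation_basis B -> homothecy_invariant B -> density_basis B ->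
  0 < fine (leb (cube 1)) ->
  exists d r : R, [/\ 0 < d, 0 < r &
    forall V, open V -> V `<=` cube 3 -> (leb V <= d%:E)%E ->
    (leb (halo (B 0 `&` [set S | S `<=` cube r]) l V `&` cube 1) <=
      (fine (leb (cube 1)) / 2)%:E)%E].
Proof.
move=> l0 dB hB densB k0; apply: contrapT => nsmall.
set k := fine (leb (cube 1)) in k0 nsmall.
(* These bounds sum to [k / 4], less than the lower bound [k / 2] for the measure of the upper limit
   of the halos. *)
pose d (i : nat) : R := k / 4 / (2 ^ i.+1)%:R.
pose F_ (i : nat) := B 0 `&` [set S | S `<=` cube i.+1%:R^-1].
have mF i S : F_ i S -> measurable (S : set LT).
  by move=> [BS _]; have [_ + _ _] := (dB 0).1 _ BS.
have /choice[V_ HV] : forall i, exists V, [/\ open V, V `<=` cube 3, (leb V <= (d i)%:E)%E &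
    ((k / 2)%:E < leb (halo (F_ i) l V `&` cube 1))%E].
  move=> i; apply: contrapT => nV; apply: nsmall; exists (d i), i.+1%:R^-1; split.
  - by rewrite !divr_gt0// ltr0n expn_gt0.
  - by rewrite invr_gt0.
  move=> V oV V3 Vd; rewrite leNgt; apply/negP => kV; apply: nV; exists V.
  by split.
pose V := \bigcup_i V_ i.
have oV : open V by apply: bigcup_open => i _; have [] := HV i.
have V3 : V `<=` cube 3 by move=> x [i _]; have [_ + _ _] := HV i; apply.
have lebV : (leb V <= (k / 4)%:E)%E.
  apply: le_trans (outer_measure_sigma_subadditive _ _) _.
  have k40 : 0 <= k / 4 by rewrite divr_ge0// ltW.
  apply: le_trans (epsilon_trick0 xpredT k40).
  by apply: lee_nneseries => [i *|i *]; [exact: outer_measure_ge0|have [] := HV i].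
have mV : measurable (V : set LT) by exact: open_lebesgue_measurable.
pose Z i := halo (F_ i) l (V_ i) `&` cube 1.
have oZ i : open (Z i).
  apply: openI; last exact: open_centered_cube.
  by apply: open_halo; [exact: mF|have [] := HV i].
pose T j := \bigcup_(i in [set i | (j <= i)%N]) Z i.
have mT j : measurable (T j : set LT).
  by apply/open_lebesgue_measurable/bigcup_open => i _.
pose L := \bigcap_j T j.
have mL : measurable (L : set LT) by exact: bigcapT_measurable.
have Tge j : ((k / 2)%:E <= leb (T j))%E.
  have [_ _ _ /ltW/le_trans] := HV j; apply; apply: le_outer_measure => x Zx.
  by exists j => //=.
have T1 j : T j `<=` cube 1 by move=> x [i _ []].
have leL : ((k / 2)%:E <= leb L)%E.
  have cT := @nonincreasing_cvg_mu _ LT R mu T _ mT mL _.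
  have {}cT : (leb \o T) i @[i --> \oo] --> leb L.
    apply: cT.
      apply: le_lt_trans (lebesgue_outer_centered_cube n 1).
      exact: (@le_outer_measure _ _ leb _ _ (T1 0%N)).
    move=> i j ij; apply/subsetPset => x [m /= jm Zm]; exists m => //=.
    exact: leq_trans ij jm.
  move/cvg_lim : (cT) => <-//; apply: lime_ge; first by apply/cvg_ex; eexists; exact: cT.
  by apply: nearW => i; exact: Tge.
have bV : bounded_set V.
  exists 3; split => // M M3 x /V3; rewrite /centered_cube /= => /ltW/le_trans; apply.
  exact: ltW.
have [N [mN N0 HN]] := densB V bV mV.
have LVN : L `<=` V `|` N.
  move=> x Lx; apply/or_asboolP; apply/negPn/negP.
  rewrite negb_or => /andP[/asboolPn nVx /asboolPn nNx]; apply: nNx; apply: HN => /= -[uV _].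
  have : (l%:E <= upper_derivative B \1_V x)%E.
    apply: upper_derivative_ge => e e0.
    have [j je] : exists j : nat, Num.sqrt n%:R * (j.+1%:R^-1 + j.+1%:R^-1) < e.
      have c0 : 0 < Num.sqrt n%:R + 1 :> R by rewrite ltr_wpDl// sqrtr_ge0.
      have e20 : 0 < e / (2 * (Num.sqrt n%:R + 1)) by rewrite divr_gt0// mulr_gt0.
      have [j] := ltr_add_invr e20; rewrite add0r ltr_pdivlMr ?mulr_gt0// => je.
      exists j; apply: le_lt_trans je.
      have j0 : 0 <= j.+1%:R^-1 :> R by [].
      rewrite [leRHS](_ : _ = Num.sqrt n%:R * (j.+1%:R^-1 + j.+1%:R^-1)
        + (j.+1%:R^-1 + j.+1%:R^-1)); last by ring.
      by rewrite lerDl addr_ge0.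
    have [i /= ji [[S [BS Si] lS] _]] := Lx j Logic.I.
    have BxS : B x (translate x S) by exact: basis_translate0.
    have [bS mS S0 _] := (dB x).1 _ BxS.
    exists (translate x S); first split => //.
      apply: le_lt_trans (diam_translate_le x Si) _; rewrite lte_fin.
      apply: le_lt_trans je; apply: ler_wpM2l; first exact: sqrtr_ge0.
      by apply: lerD; rewrite lef_pV2 ?posrE// ler_nat.
    apply: average_indic_ge => //; first exact: ltW.
      by rewrite ge0_fin_numE ?outer_measure_ge0//; exact: bounded_lebesgue_lty.
    rewrite lebesgue_translate; apply: lt_le_trans lS _; apply: le_outer_measure.
    by apply: setSI => y Vy; exists i.
  by rewrite uV indicE memNset// lee_fin leNgt l0.
have : (leb L <= (k / 4)%:E)%E.
  apply: (@le_trans _ _ (leb (V `|` N))); first exact: le_outer_measure.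
  apply: le_trans (outer_measureU2 _ _ _) _.
  by rewrite -[leRHS]adde0; apply: leeD => //; rewrite -N0.
move=> /(le_trans leL); rewrite lee_fin; lra.
Qed.

(** A set of [B 0] has positive measure and lies in some [cube r], which is a dilate of [cube 1]. *)
Lemma basis_cube_pos : differentiation_basis B -> 0 < fine (leb (cube 1)).
Proof.
move=> dB; have [E_ [BE _]] := (dB 0).2.
have [bE mE E0 _] := (dB 0).1 _ (BE 0%N).
have [r r0 Er] := bounded_setP bE.
apply: fine_gt0; rewrite lebesgue_outer_centered_cube andbT.
have : (0 < leb (cube r))%E by apply: lt_le_trans E0 _; exact: le_outer_measure.
rewrite (_ : cube r = dilate r (cube 1)); last first.
  apply/funext => x; rewrite /centered_cube /dilate /= normrZ gtr0_norm ?invr_gt0//.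
  by rewrite mulrC ltr_pdivrMr// mul1r.
by rewrite lebesgue_dilate// pmule_rgt0// lte_fin exprn_gt0.
Qed.

Theorem density_basis_halo_weak_type l :
  0 < l -> differentiation_basis B -> homothecy_invariant B -> density_basis B ->
  exists2 C : R, 0 < C &
    forall E, open E -> (leb (halo (B 0) l E) <= C%:E * leb E)%E.
Proof.
move=> l0 dB hB densB; have k0 := basis_cube_pos dB.
have [d [r [d0 r0 small]]] := density_basis_halo_small l0 dB hB densB k0.
apply: (halo_weak_type d0 r0 k0 _ _ _ small).
- by move=> S BS; have [_ + _ _] := (dB 0).1 _ BS.
- by move=> S BS; have [/bounded_setP[s _ ?] _ _ _] := (dB 0).1 _ BS; exists s.
- by move=> S s s0; exact: basis_dilate.
Qed.

End density_basis.

(** * Convex bodies *)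

Record symmetric_body (R : realType) (n : nat) (K : set 'rV[R]_n) : Prop :=
  SymmetricBody {
    symmetric_body_open : open K;
    symmetric_body_opp : forall x, K x -> K (- x);
    symmetric_body_convex : forall x y (a : R), 0 <= a <= 1 ->
      K x -> K y -> K (a *: x + (1 - a) *: y);
    symmetric_body_bounded : exists r, K `<=` centered_cube r
  }.

Section convex_body.
Context (R : realType) (n : nat).
Implicit Types (S : set 'rV[R]_n) (x y u : 'rV[R]_n).

Local Notation leb := (lebesgue_outer_measure R n).
Local Notation LT := (lebesgue_type R n).
Local Notation mu := (lebesgue R n).
Local Notation cube := (@centered_cube R n).

Lemma convex_setP S x y (a : R) : convex_set S -> 0 <= a <= 1 ->
  S x -> S y -> S (a *: x + (1 - a) *: y).
Proof.
move=> cS /andP[a0 a1] Sx Sy.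
have := cS x y (Itv01 a0 a1); rewrite !inE => /(_ Sx Sy).
by [].
Qed.

(** The missing weight goes to the origin. In the inductive step the tail is rescaled by
    [1 / (1 - c i)]; if [c i = 1], the tail vanishes. *)
Lemma convex_sum S (I : Type) (r : seq I) (c : I -> R) (a : I -> 'rV[R]_n) :
  convex_set S -> S 0 -> (forall i, 0 <= c i) -> (forall i, S (a i)) ->
  \sum_(i <- r) c i <= 1 -> S (\sum_(i <- r) c i *: a i).
Proof.
move=> cS S0 + Sa; elim: r c => [|i r IH] c c0; first by rewrite !big_nil.
rewrite !big_cons => ci1.
have sr0 : 0 <= \sum_(j <- r) c j by apply: sumr_ge0.
have [ci|ci] := eqVneq (c i) 1.
  have s0 : \sum_(j <- r) c j = 0.
    by apply/eqP; rewrite eq_le sr0 andbT; move: ci1; rewrite ci; lra.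
  have -> : \sum_(j <- r) c j *: a j = 0.
    elim: r s0 {IH ci1 sr0} => [|j r IHr]; first by rewrite !big_nil.
    rewrite !big_cons => /eqP; rewrite paddr_eq0 ?sumr_ge0// => /andP[/eqP cj0 /eqP/IHr ->].
    by rewrite cj0 scale0r addr0.
  by rewrite ci scale1r addr0.
have ci_lt : 0 < 1 - c i by rewrite subr_gt0 lt_neqAle ci/=; lra.
have -> : \sum_(j <- r) c j *: a j =
    (1 - c i) *: (\sum_(j <- r) ((1 - c i)^-1 * c j) *: a j).
  rewrite scaler_sumr; apply: eq_bigr => j _.
  by rewrite scalerA mulrA mulfV ?mul1r// gt_eqF.
apply: convex_setP => //; first by rewrite c0/=; lra.
apply: IH => [j|]; first by rewrite mulr_ge0// invr_ge0 ltW.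
by rewrite -mulr_sumr mulrC ler_pdivrMr// mul1r; lra.
Qed.

(** The translates of [S] by [1/(j+1)] along a coordinate vector with [v i != 0] are pairwise
    disjoint and lie in one cube; infinitely many disjoint sets of the same positive measure do not
    fit there. *)
Lemma hyperplane_lebesgue0 S (v : 'cV[R]_n) (r : R) : v != 0 ->
  measurable (S : set LT) -> S `<=` cube r -> (forall x, S x -> x *m v = 0) ->
  leb S = 0%E.
Proof.
move=> v0 mS Sr Sv; apply/eqP; rewrite eq_le outer_measure_ge0 andbT leNgt.
apply/negP => S0.
have [i vi] : exists i, v i 0 != 0.
  apply: contrapT => /forallNP nv; move/eqP: v0; apply; apply/matrixP => i j.
  by rewrite ord1 mxE; apply/eqP/negPn/negP; exact: nv.
pose t (j : nat) : 'rV[R]_n := j.+1%:R^-1 *: delta_mx 0 i.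
pose G j := translate (t j) S.
have tG : trivIset setT G.
  move=> j k _ _ [x [/Sv Gj /Sv Gk]].
  have : (t j - t k) *m v = 0.
    have -> : t j - t k = (x - t k) - (x - t j).
      by rewrite [RHS]addrC opprB addrA subrK.
    by rewrite mulmxBl Gj Gk subrr.
  rewrite /t -scalerBl -scalemxAl -rowE => /matrixP/(_ 0 0); rewrite !mxE => /eqP.
  rewrite mulf_eq0 (negbTE vi) orbF subr_eq0 => /eqP/invr_inj/eqP.
  by rewrite eqr_nat => /eqP[].
have mG j : measurable (G j : set LT) by exact: measurable_translate.
have Gcube : \bigcup_j G j `<=` cube (r + 1).
  move=> x [j _ /Sr]; rewrite /centered_cube /= => xr.
  rewrite -[x](subrK (t j)) (le_lt_trans (ler_normD _ _))//.
  apply: ltr_leD => //; rewrite /t normrZ gtr0_norm ?invr_gt0//.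
  have di1 : `|delta_mx 0 i : 'rV[R]_n| <= 1.
    rewrite [leLHS]mx_normrE; apply/bigmax_leP; split => // -[a b] _ /=.
    by rewrite mxE normr_nat lern1 leq_b1.
  by rewrite (le_trans (ler_wpM2l _ di1))// mulr1 invf_le1// ler1n.
have := lebesgue_outer_centered_cube n (r + 1); apply/negP; rewrite -leNgt.
apply: (@le_trans _ _ (leb (\bigcup_j G j))); last exact: (@le_outer_measure _ _ leb).
have -> : leb (\bigcup_j G j) = (\sum_(0 <= j <oo) leb (G j))%E.
  rewrite (@measure_bigcup _ R LT mu setT G (fun j _ => mG j) tG).
  by apply: eq_eseriesl => j; rewrite in_setT.
rewrite (eq_eseriesr (g := fun=> leb S)); last first.
  by move=> j _; rewrite /G lebesgue_translate.
rewrite leye_eq; apply/eqP.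
have fS : leb S \is a fin_num by exact: sub_centered_cube_fin Sr.
apply/eqyP => M M0.
have s0 : 0 < fine (leb S) by apply: fine_gt0; rewrite S0 ltey_eq fS.
apply: le_trans (nneseries_lim_ge (Num.bound (M / fine (leb S))) _); last first.
  by move=> *; exact: outer_measure_ge0.
rewrite -(fineK fS) sumEFin sumr_const_nat subn0 lee_fin -mulr_natl.
by rewrite -ler_pdivrMr// ltW// archi_boundP// divr_ge0 ?ltW.
Qed.

Lemma norm_mulmx_le (A : 'M[R]_n) : exists2 M : R, 0 < M & forall x, `|x *m A| <= M * `|x|.
Proof.
pose M : R := 1 + \sum_i \sum_j `|A i j|.
have M0 : 0 < M by rewrite ltr_pwDl// sumr_ge0// => i _; rewrite sumr_ge0.
exists M => // x; rewrite [leLHS]mx_normrE; apply/bigmax_leP; split.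
  by rewrite mulr_ge0// ltW.
move=> [a j] _ /=; rewrite ord1 mxE (le_trans (ler_norm_sum _ _ _))//.
apply: (@le_trans _ _ (\sum_i `|x| * `|A i j|)).
  by apply: ler_sum => i _; rewrite normrM ler_wpM2r// coord_le_norm.
rewrite -mulr_sumr mulrC ler_wpM2r// /M ler_wpDl// ler_sum// => i _.
by rewrite (bigD1 j)//= lerDl sumr_ge0.
Qed.

(** As long as fewer than [n] rows are chosen, some nonzero [v] is orthogonal to them all. Having
    positive measure, [S] is not contained in the hyperplane [x *m v = 0], and a point of [S]
    outside it is the next row. *)
Lemma exists_row_free S k : (k <= n)%N ->
  measurable (S : set LT) -> (exists r, S `<=` cube r) -> (0 < leb S)%E ->
  exists M : 'M[R]_(k, n), row_free M /\ forall i, S (row i M).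
Proof.
move=> kn mS [r Sr] S0; elim: k kn => [_|k IH kn].
  by exists 0; split; [rewrite /row_free mxrank0|case].
have [M [fM SM]] := IH (ltnW kn).
have /eqP cM : cokermx M != 0.
  rewrite cokermx_eq0 /row_full; move: fM; rewrite /row_free => /eqP ->.
  by rewrite neq_ltn kn.
have [j vj] : exists j, col j (cokermx M) != 0.
  apply: contrapT => /forallNP nv; apply: cM; apply/matrixP => i j.
  have /negP/negPn/eqP/matrixP/(_ i 0) := nv j.
  by rewrite !mxE.
set v := col j _ in vj.
have Mv : M *m v = 0 by rewrite /v colE mulmxA mulmx_coker mul0mx.
have [u Su uv] : exists2 u, S u & u *m v != 0.
  apply: contrapT => nu; move: S0; apply/negP; rewrite -leNgt.
  rewrite (hyperplane_lebesgue0 vj mS Sr)// => x Sx; apply/eqP/negPn/negP => xv.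
  by apply: nu; exists x.
have fuM : row_free (col_mx u M).
  apply: inj_row_free => w; rewrite -[w]hsubmxK mul_row_col => w0.
  have : lsubmx w *m (u *m v) = 0.
    move/(congr1 (fun z => z *m v)): w0; rewrite mulmxDl mul0mx -!mulmxA Mv mulmx0.
    by rewrite addr0.
  move=> w10; have {w10}w1 : lsubmx w = 0.
    apply/matrixP => a b; rewrite !ord1 [RHS]mxE.
    move/matrixP/(_ 0 0): w10; rewrite mxE big_ord1 [RHS]mxE => /eqP.
    rewrite mulf_eq0 => /orP[/eqP//|uv0].
    case/negP: uv; apply/eqP/matrixP => c d; rewrite !ord1 [RHS]mxE; exact/eqP.
  move: w0; rewrite w1 mul0mx add0r => w2.
  have -> : rsubmx w = 0 by apply: (row_free_inj fM); rewrite w2 mul0mx.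
  by rewrite row_mx0.
have SuM (i : 'I_(1 + k)) : S (row i (col_mx u M)).
  by case: (split_ordP i) => i' ->; rewrite ?rowKu ?rowKd// [i']ord1 row_id.
by exists (col_mx u M : 'M[R]_((1 + k)%N, n)); split.
Qed.

Definition replace_row (T : 'M[R]_n) (i : 'I_n) u : 'M[R]_n :=
  \matrix_(a, b) if a == i then u 0 b else T a b.

Lemma row_replace_row T i u a :
  row a (replace_row T i u) = if a == i then u else row a T.
Proof. by apply/rowP => b; rewrite !mxE; case: ifP => // _; rewrite mxE. Qed.

Lemma det_replace_row1 i u : \det (replace_row 1%:M i u) = u 0 i.
Proof.
rewrite (expand_det_col _ i) (bigD1 i)//= big1 ?addr0 => [|a ai]; last first.
  by rewrite !mxE (negbTE ai) mul0r.
rewrite mxE eqxx /cofactor addnn -signr_odd odd_double expr0 mul1r.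
rewrite (_ : row' i _ = 1%:M) ?det1 ?mulr1//.
apply/matrixP => a b; rewrite !mxE eq_sym (negbTE (neq_lift _ _)).
by rewrite (inj_eq lift_inj).
Qed.

(** Cramer's rule: [replace_row T i u] is the product of [replace_row 1%:M i (u *m invmx T)] and
    [T]. *)
Lemma det_replace_row T i u : T \in unitmx ->
  \det (replace_row T i u) = (u *m invmx T) 0 i * \det T.
Proof.
move=> uT; rewrite -det_replace_row1 -det_mulmx; congr (\det _).
apply/row_matrixP => a; rewrite row_mul !row_replace_row; case: ifP => _.
  by rewrite mulmxKV.
by rewrite row1 -rowE.
Qed.

(* Rows of almost maximal determinant form a basis in which, by Cramer's rule,
   all points of S have bounded coordinates. *)
Lemma exists_bounded_frame S :
  measurable (S : set LT) -> (exists r, S `<=` cube r) -> (0 < leb S)%E ->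
  exists T : 'M[R]_n, [/\ T \in unitmx, forall i, S (row i T) &
    forall u i, S u -> `|(u *m invmx T) 0 i| <= 2].
Proof.
move=> mS [r Sr] S0.
pose D : set R := [set `|\det T| | T in [set T : 'M[R]_n | forall i, S (row i T)]].
have [M [fM SM]] := exists_row_free (leqnn n) mS (ex_intro _ r Sr) S0.
have dM : 0 < `|\det M|.
  by rewrite normr_gt0 -unitfE; move: fM; rewrite row_free_unit unitmxE.
have DM : D `|\det M| by exists M.
have supD : has_sup D.
  split; first by exists `|\det M|.
  exists (\sum_(s : 'S_n) \prod_(i < n) r) => _ [T ST <-].
  rewrite /determinant (le_trans (ler_norm_sum _ _ _))//; apply: ler_sum => s _.
  rewrite normrM normrX normrN1 expr1n mul1r normr_prod; apply: ler_prod => i _.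
  rewrite normr_ge0/=; have /Sr/ltW := ST i; apply: le_trans.
  by have := coord_le_norm (row i T) (s i); rewrite mxE.
have sup0 : 0 < sup D by apply: lt_le_trans dM _; exact: ub_le_sup supD.2 _ DM.
(* Since [S] need not be closed, the supremum may not be attained; a determinant above half of it
   gives the bound 2 on the coordinates. *)
have sup20 : 0 < sup D / 2 by rewrite divr_gt0.
have [_ [T ST <-] ltT] := sup_adherent sup20 supD.
have dT : 0 < `|\det T| by apply: le_lt_trans ltT; rewrite subr_ge0; lra.
have uT : T \in unitmx by rewrite unitmxE unitfE -normr_gt0.
exists T; split => // u i Su.
have : D `|\det (replace_row T i u)|.
  by exists (replace_row T i u) => // a; rewrite row_replace_row; case: ifP.
move=> /(ub_le_sup supD.2); rewrite det_replace_row// normrM => le_sup.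
rewrite -(ler_pM2r dT); apply: le_trans le_sup _; lra.
Qed.

(** [K] is the image under [T] of the open cube of half side 3, which exceeds the bound 2 on the
    coordinates of [S]. The point [c] has all coordinates [1/(2n)] in this frame, and [k/(6n)] moves
    each by less than [3/(6n) = 1/(2n)]. The coordinates thus stay in [[0, 1/n]], have sum at most
    1, and define a convex combination of the rows of [T] and 0, all in [S]. *)
Lemma exists_symmetric_body S : (0 < n)%N -> convex_set S -> S 0 ->
  measurable (S : set LT) -> (exists r, S `<=` cube r) -> (0 < leb S)%E ->
  exists K c, [/\ symmetric_body K, S `<=` K &
    forall k, K k -> S (c + (6 * n%:R)^-1 *: k)].
Proof.
move=> n0 cS S0 mS bS leS0; have [T [uT ST STle]] := exists_bounded_frame mS bS leS0.
have [M M0 HM] := norm_mulmx_le (invmx T).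
have [M' M'0 HM'] := norm_mulmx_le T.
pose K := [set x : 'rV[R]_n | `|x *m invmx T| < 3].
have nn0 : 0 < n%:R :> R by rewrite ltr0n.
exists K, (const_mx (2 * n%:R)^-1 *m T); split.
- split.
  + apply/open_normP => x Kx; exists ((3 - `|x *m invmx T|) / M).
      by rewrite divr_gt0// subr_gt0.
    move=> y; rewrite ltr_pdivlMr// mulrC => yx; rewrite /K /=.
    rewrite -(subrK x y) mulmxDl (le_lt_trans (ler_normD _ _))// -ltrBrDr.
    exact: le_lt_trans (HM _) yx.
  + by move=> x; rewrite /K /= mulNmx normrN.
  + move=> x y a /andP[a0 a1] Kx Ky; rewrite /K /= mulmxDl -!scalemxAl.
    rewrite (le_lt_trans (ler_normD _ _))// !normrZ ger0_norm// ger0_norm ?subr_ge0//.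
    move: Kx Ky; rewrite /K /=; move: `|_| `|_| => p q p3 q3.
    by have [->|a00] := eqVneq a 0; nra.
  + exists (M' * 3) => x Kx; rewrite /centered_cube /= -[x](mulmxKV uT).
    by rewrite (le_lt_trans (HM' _))// ltr_pM2l.
- move=> u Su; apply: norm_lt_coord => // i.
  by rewrite (le_lt_trans (STle _ _ Su))// ltr_nat.
move=> k Kk; rewrite -[k](mulmxKV uT) scalemxAl -mulmxDl mulmx_sum_row.
have ki i : `|(k *m invmx T) 0 i| < 3 by exact: le_lt_trans (coord_le_norm _ _) Kk.
move: (k *m invmx T) ki => w wi {k Kk}.
pose a : R := (2 * n%:R)^-1.
have a0 : 0 < a by rewrite invr_gt0 mulr_gt0.
have aa : a + a = n%:R^-1 by rewrite /a invfM -mulrDl (_ : 2^-1 + 2^-1 = 1) ?mul1r//; lra.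
have b3 : (6 * n%:R)^-1 = a / 3 by rewrite /a -invfM; congr _^-1; ring.
have wb i : 0 <= (const_mx a + (6 * n%:R)^-1 *: w) 0 i <= n%:R^-1.
  rewrite !mxE b3 -aa mulrAC; have := wi i; rewrite ltr_norml => /andP[w1 w2].
  by apply/andP; split; nra.
rewrite -/a; apply: convex_sum => // [i|]; first by case/andP: (wb i).
apply: (@le_trans _ _ (\sum_(i < n) n%:R^-1)).
  by apply: ler_sum => i _; case/andP: (wb i).
by rewrite sumr_const card_ord -[leLHS]mulr_natl mulfV// gt_eqF.
Qed.

End convex_body.

(** * Expansion operator *)

(** The properties of [B 0] on which the expansion argument rests; [convex_family_weak_type] says
    nothing of how [C] depends on [l]. *)
Record convex_family (R : realType) (n : nat) (F : set (set 'rV[R]_n)) : Prop :=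
  ConvexFamily {
    convex_family_measurable : forall S, F S -> measurable (S : set (lebesgue_type R n));
    convex_family_bounded : forall S, F S -> exists r, S `<=` centered_cube r;
    convex_family_pos : forall S, F S -> (0 < lebesgue_outer_measure R n S)%E;
    convex_family0 : forall S, F S -> S 0;
    convex_family_convex : forall S, F S -> convex_set S;
    convex_family_dilate : forall S s, 0 < s -> F S -> F (dilate s S);
    convex_family_weak_type : forall l, 0 < l -> exists2 C : R, 0 < C &
      forall E, open E ->
        (lebesgue_outer_measure R n (halo F l E) <= C%:E * lebesgue_outer_measure R n E)%E
  }.

Lemma subr_recenter (V : zmodType) (a w y z : V) :
  z - w = a + ((z - y) - (w - (y - a))).
Proof. by rewrite opprB -(addrA y) (addrA (z - y)) subrK addrCA addNKr. Qed.

Section expansion.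
Context (R : realType) (n : nat) (F : set (set 'rV[R]_n)).
Hypothesis n0 : (0 < n)%N.
Hypothesis FF : convex_family F.
Implicit Types (A E S V W K O : set 'rV[R]_n) (x y c t : 'rV[R]_n) (l r s : R).

Local Notation leb := (lebesgue_outer_measure R n).
Local Notation LT := (lebesgue_type R n).
Local Notation cube := (@centered_cube R n).

Let d : R := (6 * n%:R)^-1.

Let n_gt0 : 0 < n%:R :> R. Proof. by rewrite ltr0n. Qed.

Let d0 : 0 < d. Proof. by rewrite invr_gt0 mulr_gt0. Qed.

Definition body_of S K c := [/\ symmetric_body K, S `<=` K &
  forall k, K k -> S (c + d *: k)].

Lemma symmetric_body_half K x y : symmetric_body K -> K x -> K y -> K (2^-1 *: (x + y)).
Proof.
move=> sK Kx Ky; have h : 0 <= (2^-1 : R) <= 1 by rewrite invr_ge0 ler0n invf_le1 ?ler1n.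
have := @symmetric_body_convex _ _ _ sK x y _ h Kx Ky.
rewrite (_ : 1 - 2^-1 = 2^-1); last lra.
by rewrite -scalerDr.
Qed.

Lemma symmetric_body_dilate K s : 0 < s -> symmetric_body K -> symmetric_body (dilate s K).
Proof.
move=> s0 [oK nK cK [r Kr]]; split.
- exact: open_dilate.
- by move=> x; rewrite /dilate /= scalerN; exact: nK.
- move=> x y a a01 Kx Ky; rewrite /dilate /= scalerDr !scalerA ![s^-1 * _]mulrC -!scalerA.
  exact: cK.
- exists (s * r) => x /Kr; rewrite /centered_cube /= normrZ gtr0_norm ?invr_gt0//.
  by rewrite mulrC ltr_pdivrMr// mulrC.
Qed.

Lemma body_of_dilate S K c s : 0 < s -> body_of S K c ->
  body_of (dilate s S) (dilate s K) (s *: c).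
Proof.
move=> s0 [sK SK KS]; split; first exact: symmetric_body_dilate.
  by move=> x /SK.
move=> k /KS; rewrite /dilate /= scalerDr !scalerA mulVf ?gt_eqF// scale1r.
by rewrite (mulrC d).
Qed.

Lemma exists_body_of S : F S -> exists K c, body_of S K c.
Proof.
move=> FS; apply: exists_symmetric_body => //.
- exact: convex_family_convex FF _ FS.
- exact: convex_family0 FF _ FS.
- exact: convex_family_measurable FF _ FS.
- exact: convex_family_bounded FF _ FS.
- exact: convex_family_pos FF _ FS.
Qed.

(** For [k] and [k'] in [K], [(k - k') / t] is [d] times the midpoint of [k] and [- k']; hence [t S]
    contains [t c + (K - K)]. *)
Let t : R := 2 / d.

Let t0 : 0 < t. Proof. by rewrite divr_gt0. Qed.

Let tV : t^-1 = d * 2^-1. Proof. by rewrite /t invf_div. Qed.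

Let tn0 : 0 < t ^+ n. Proof. by rewrite exprn_gt0. Qed.

(** Density above 1/2 in a copy of [K] gives density above [2^-(n+1)] in a copy twice as large
    containing it. *)
Definition low_density : R := 2^-1 ^+ n.+1.

Lemma low_density_gt0 : 0 < low_density.
Proof. by rewrite exprn_gt0. Qed.

Lemma low_density_lt_half : low_density < 2^-1.
Proof.
by rewrite /low_density exprS gtr_pMr// exprn_ilt1 -?lt0n//; lra.
Qed.

(* Two passes are needed since the base point 0 may lie on the boundary of S:
   the first pass reaches a translate of y + K, the second one, made with the
   reflected sets, brings that translate back onto y + K. *)
Definition expand E := halo (@reflect R n @` F) ((2 * t ^+ n)^-1)
  (halo F (low_density / t ^+ n) E).

Let halo_arg_gt0 : 0 < low_density / t ^+ n.
Proof. by rewrite divr_gt0 ?low_density_gt0. Qed.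

Lemma open_halo_family l E : open E -> open (halo F l E).
Proof. by move=> oE; apply: open_halo => // S; exact: convex_family_measurable. Qed.

Lemma open_expand E : open E -> open (expand E).
Proof.
move=> oE; apply: open_halo; last exact: open_halo_family.
by move=> _ [S FS <-]; apply/measurable_reflect/(convex_family_measurable FF).
Qed.

(** A halo for the reflected family is the reflection of a halo for [F], so the weak type bounds of
    [F] serve for both passes. *)
Lemma expand_le : exists2 C : R, 1 <= C & forall E, open E -> (leb (expand E) <= C%:E * leb E)%E.
Proof.
have [C1 C10 H1] := convex_family_weak_type FF halo_arg_gt0.
have m0 : 0 < (2 * t ^+ n)^-1 by rewrite invr_gt0 mulr_gt0.
have [C2 C20 H2] := convex_family_weak_type FF m0.
exists (Num.max 1 (C2 * C1)); first by rewrite le_max lexx.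
move=> E oE; have oH := @open_halo_family (low_density / t ^+ n) E oE.
rewrite /expand -[halo F (low_density / _) E]reflectK halo_reflect lebesgue_reflect.
apply: le_trans (H2 _ (open_reflect oH)) _; rewrite lebesgue_reflect.
apply: (@le_trans _ _ (C2%:E * (C1%:E * leb E))%E).
  by apply: lee_wpmul2l; [rewrite lee_fin ltW|exact: H1].
rewrite muleA -EFinM; apply: lee_wpmul2r; first exact: outer_measure_ge0.
by rewrite lee_fin le_max lexx orbT.
Qed.

Lemma body_fin S K c : body_of S K c -> leb K \is a fin_num.
Proof. by move=> [[_ _ _ [r Kr]] _ _]; exact: sub_centered_cube_fin Kr. Qed.

Lemma body_pos S K c : F S -> body_of S K c -> (0 < leb K)%E.
Proof.
move=> FS [_ SK _]; apply: lt_le_trans (convex_family_pos FF FS) _.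
exact: le_outer_measure.
Qed.

(** For [w] in [y - t c + K], the set [w + t S] contains [y + K] and has measure at most [t^n |K|],
    so this translate of [K] lies in the first halo. For [w] in [y + K], the reflected set [w - t S]
    contains that translate, with relative measure at least [t^-n], above the level
    [1 / (2 t^n)]. *)
Lemma sub_expand S K c y E : F S -> body_of S K c ->
  (low_density%:E * leb K < leb (E `&` translate y K))%E ->
  translate y K `<=` expand E.
Proof.
move=> FS bSK lK; have [sK SK KS] := bSK.
have Kfin := body_fin bSK; have Kpos := body_pos FS bSK.
have key k k' : K k -> K k' -> S (t^-1 *: (t *: c + (k - k'))).
  move=> Kk Kk'; rewrite scalerDr scalerA mulVf ?gt_eqF// scale1r tV -scalerA.
  by apply: KS; apply: symmetric_body_half => //; exact: symmetric_body_opp.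
have FtS : F (dilate t S) by exact: convex_family_dilate.
have leSK : (leb S <= leb K)%E by exact: le_outer_measure.
have first_pass : translate (y - t *: c) K `<=` halo F (low_density / t ^+ n) E.
  move=> w Kw; exists (dilate t S) => //.
  rewrite lebesgue_dilate// muleA -EFinM divfK ?gt_eqF//.
  apply: (@le_lt_trans _ _ (low_density%:E * leb K)%E).
    by apply: lee_wpmul2l => //; rewrite lee_fin ltW// low_density_gt0.
  apply: lt_le_trans lK _; apply: le_outer_measure; apply: setIS => z Kz.
  rewrite /translate /dilate /=.
  rewrite (_ : z - w = t *: c + ((z - y) - (w - (y - t *: c)))); first exact: key.
  exact: subr_recenter.
move=> w Kw; exists (reflect (dilate t S)); first by exists (dilate t S).
rewrite lebesgue_reflect lebesgue_dilate// muleA -EFinM.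
apply: (@le_lt_trans _ _ ((2^-1)%:E * leb K)%E).
  rewrite invfM mulfVK ?gt_eqF//.
  by apply: lee_wpmul2l => //; rewrite lee_fin.
apply: (@lt_le_trans _ _ (leb (translate (y - t *: c) K))).
  rewrite lebesgue_translate -(fineK Kfin) -EFinM lte_fin.
  have : 0 < fine (leb K) by apply: fine_gt0; rewrite Kpos ltey_eq Kfin.
  lra.
apply: le_outer_measure => z Kz; split; first exact: first_pass.
rewrite /translate /reflect /dilate /=.
rewrite (_ : - (z - w) = t *: c + ((w - y) - (z - (y - t *: c)))); first exact: key.
rewrite opprB; exact: subr_recenter.
Qed.

End expansion.

(** * Growth of the density under expansion *)

Section growth.
Context (R : realType) (n : nat) (F : set (set 'rV[R]_n)).
Hypothesis n0 : (0 < n)%N.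
Hypothesis FF : convex_family F.
Implicit Types (A E S V W K O U : set 'rV[R]_n) (x y c t : 'rV[R]_n) (l r s : R).

Local Notation leb := (lebesgue_outer_measure R n).
Local Notation LT := (lebesgue_type R n).
Local Notation cube := (@centered_cube R n).
Local Notation expand := (@expand R n F).
Local Notation low_density := (@low_density R n).

(* The image of x + K under the homothecy of center y and ratio s. *)
Definition shrink K x y s := translate (y + s *: (x - y)) (dilate s K).

Lemma shrinkP K x y s z : 0 < s ->
  shrink K x y s z <-> exists2 k, K k & z = y + s *: (x - y) + s *: k.
Proof.
move=> s0; split => [Kz|[k Kk ->]].
  exists (s^-1 *: (z - (y + s *: (x - y)))) => //.
  by rewrite scalerA mulfV ?gt_eqF// scale1r addrC subrK.
rewrite /shrink /translate /dilate /= addrC addKr scalerA mulVf ?gt_eqF//.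
by rewrite scale1r.
Qed.

Lemma shrink_sub K x y s : symmetric_body K -> translate x K y -> 0 < s <= 1 ->
  shrink K x y s `<=` translate x K.
Proof.
move=> sK Ky /andP[s0 s1] z /(shrinkP _ _ _ _ s0)[k Kk ->]; rewrite /translate /=.
rewrite (_ : _ - x = s *: k + (1 - s) *: (y - x)).
  by apply: (symmetric_body_convex sK) => //; rewrite (ltW s0).
by apply/rowP => i; rewrite !mxE; ring.
Qed.

(** As [y - x] is in [K], so is the midpoint of [k] and [y - x] for every [k] in [K]; it represents
    the same point in the copy of twice the ratio. *)
Lemma shrink_halve K x y s : symmetric_body K -> translate x K y -> 0 < s ->
  shrink K x y s `<=` shrink K x y (2 * s).
Proof.
move=> sK Ky s0 z /(shrinkP _ _ _ _ s0)[k Kk ->].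
apply/shrinkP; first by rewrite mulr_gt0.
exists (2^-1 *: (k + (y - x))); first exact: symmetric_body_half.
by apply/rowP => i; rewrite !mxE; field.
Qed.

Lemma shrink1 K x y : shrink K x y 1 = translate x K.
Proof.
apply/funext => z; rewrite /shrink /translate /dilate /= invr1 !scale1r.
by rewrite [y + _]addrC subrK.
Qed.

Lemma shrink_center K x y s : 0 < s -> translate x K y ->
  shrink K x y s y.
Proof.
move=> s0 Ky; apply/shrinkP => //; exists (y - x) => //.
by apply/rowP => i; rewrite !mxE; ring.
Qed.

Lemma shrink_eventually K x y E : symmetric_body K -> translate x K y -> open E -> E y ->
  exists m, shrink K x y (2^-1 ^+ m) `<=` E.
Proof.
move=> sK Ky /open_normP/[apply] -[e e0 eE]; have [r Kr] := symmetric_body_bounded sK.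
have r0 : 0 < r by have /Kr := Ky; exact: le_lt_trans.
have e2 : 0 < e / (r + r) by rewrite divr_gt0// addr_gt0.
have [m me] : exists m : nat, 2^-1 ^+ m < e / (r + r).
  have [m] := ltr_add_invr e2; rewrite add0r => me; exists m.+1.
  apply: le_lt_trans me; rewrite exprVn lef_pV2 ?posrE ?exprn_gt0//.
  by rewrite -natrX ler_nat ltnW// ltn_expl.
have m0 : 0 < 2^-1 ^+ m :> R by rewrite exprn_gt0.
exists m => z /(shrinkP _ _ _ _ m0)[k Kk ->]; apply: eE.
rewrite (_ : _ - y = 2^-1 ^+ m *: (k - (y - x))); last first.
  by apply/rowP => i; rewrite !mxE; ring.
rewrite normrZ gtr0_norm//; move: me; rewrite ltr_pdivlMr ?addr_gt0//.
apply: le_lt_trans; rewrite ler_pM2l// (le_trans (ler_normB _ _))//.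
by rewrite lerD// ltW//; [exact: Kr Kk|exact: Kr Ky].
Qed.

Lemma lebesgue_shrink K x y s : 0 < s -> leb (shrink K x y s) = ((s ^+ n)%:E * leb K)%E.
Proof. by move=> s0; rewrite /shrink lebesgue_translate lebesgue_dilate. Qed.

(* The last dyadic copy in which the density of E does not exceed 1/2. *)
Lemma exists_stopping_copy S K c x y E : F S -> body_of S K c -> open E ->
  (leb (E `&` translate x K) <= (2^-1)%:E * leb K)%E -> (E `&` translate x K) y ->
  exists s, [/\ 0 < s <= 1,
    (low_density%:E * leb (dilate s K) < leb (E `&` shrink K x y s))%E &
    (leb (E `&` shrink K x y s) <= (2^-1)%:E * leb (dilate s K))%E].
Proof.
move=> FS bSK oE Qlow [Ey Ky]; have [sK SK KS] := bSK.
have Kfin := body_fin bSK; have Kpos := body_pos FF FS bSK.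
pose dense m := ((2^-1)%:E * leb (dilate (2^-1 ^+ m) K) <
  leb (E `&` shrink K x y (2^-1 ^+ m)))%E.
have h0 m : 0 < 2^-1 ^+ m :> R by rewrite exprn_gt0.
have h1 m : 2^-1 ^+ m <= 1 :> R by rewrite exprn_ile1//; lra.
have exm : exists m, dense m.
  have [m mE] := shrink_eventually sK Ky oE Ey; exists m; rewrite /dense.
  rewrite (_ : E `&` _ = shrink K x y (2^-1 ^+ m)); last by apply/setIidr.
  rewrite lebesgue_shrink// lebesgue_dilate// -(fineK Kfin) -!EFinM lte_fin.
  have k0 : 0 < fine (leb K) by apply: fine_gt0; rewrite Kpos ltey_eq Kfin.
  have : 0 < (2^-1 ^+ m) ^+ n * fine (leb K) by rewrite mulr_gt0 ?exprn_gt0.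
  by move: (_ * fine _) => z; lra.
(* The least [m] with density above 1/2 is not 0, because of [Qlow]; the copy for its predecessor is
   the one sought. *)
case: (ex_minnP exm) => -[|m] dm minm.
  move: dm; rewrite /dense expr0 shrink1 lebesgue_dilate// expr1n mul1e.
  by rewrite ltNge Qlow.
exists (2^-1 ^+ m); split; first by rewrite h0 h1.
  2: {
  by rewrite leNgt; apply/negP => dm'; have := minm _ dm'; rewrite ltnn. }
apply: (@le_lt_trans _ _ ((2^-1)%:E * leb (dilate (2^-1 ^+ m.+1) K))%E).
  rewrite !lebesgue_dilate// !muleA -!EFinM; apply: lee_wpmul2r => //.
  rewrite lee_fin /low_density exprS -mulrA ler_pM2l ?invr_gt0//.
  by rewrite exprS exprMn.
apply: lt_le_trans dm _; apply: le_outer_measure; apply: setIS.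
by have := @shrink_halve K x y (2^-1 ^+ m.+1) sK Ky (h0 _); rewrite exprS mulrA mulfV ?mul1r.
Qed.

(* No covering lemma is needed: the selected copies P have at least half of
   their measure in U minus E, so the bound for expand applied to open
   supersets of U minus E gives |U| <= C |U minus E|. *)
Lemma expand_growth (C : R) S K c x E : 1 <= C ->
  (forall O, open O -> (leb (expand O) <= C%:E * leb O)%E) ->
  F S -> body_of S K c -> open E ->
  (leb (E `&` translate x K) <= (2^-1)%:E * leb K)%E ->
  ((1 + C^-1)%:E * leb (E `&` translate x K) <= leb (expand E `&` translate x K))%E.
Proof.
move=> C1 HC FS bSK oE Qlow; have [sK SK KS] := bSK.
have Kfin := body_fin bSK; have Kpos := body_pos FF FS bSK.
have C0 : 0 < C by exact: lt_le_trans C1.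
set Q := translate x K.
(* All translates of dilates of [K] inside [Q] where the density of [E] is above [low_density] and
   at most 1/2. Each is contained in [expand E], and together they cover [E /\ Q]. *)
pose ok (p : 'rV[R]_n * R) := let P := translate p.1 (dilate p.2 K) in
  [/\ 0 < p.2, P `<=` Q, (low_density%:E * leb (dilate p.2 K) < leb (E `&` P))%E &
   (leb (E `&` P) <= (2^-1)%:E * leb (dilate p.2 K))%E].
pose U := \bigcup_(p in ok) translate p.1 (dilate p.2 K).
have oU : open U.
  apply: bigcup_open => -[y s] [/= s0 _ _ _].
  exact/open_translate/open_dilate/(symmetric_body_open sK).
have UQ : U `<=` Q by move=> z [p [_ + _ _]]; apply.
have UE : U `<=` expand E.
  move=> z [[y s] [/= s0 _ low _]].
  apply: (sub_expand n0 FF _ (body_of_dilate s0 bSK) low).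
  exact: convex_family_dilate.
have EQU : E `&` Q `<=` U.
  move=> y EQy; have [s [/andP[s0 s1] low half]] := exists_stopping_copy FS bSK oE Qlow EQy.
  exists (y + s *: (x - y), s); last exact: (shrink_center s0 EQy.2).
  by split => //; apply: shrink_sub => //; [exact: EQy.2|rewrite s0].
have mU : measurable (U : set LT) by exact: open_lebesgue_measurable.
have mE : measurable (E : set LT) by exact: open_lebesgue_measurable.
have fsub A : A `<=` Q -> leb A \is a fin_num.
  move=> AQ; rewrite ge0_fin_numE ?outer_measure_ge0//.
  apply: (@le_lt_trans _ _ (leb Q)); first exact: le_outer_measure.
  by rewrite lebesgue_translate ltey_eq Kfin.
have fUE : leb (U `\` E) \is a fin_num by apply: fsub => z [/UQ].
have fEQ : leb (E `&` Q) \is a fin_num by exact: fsub (@subIsetr _ _ _).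
have fU := fsub _ UQ.
have UO O : open O -> U `\` E `<=` O -> U `<=` expand O.
  move=> oO UEO z Uz; have [[y s] okp Pz] := Uz; have [/= s0 PQ low half] := okp.
  pose P := translate y (dilate s K).
  have Kdil := body_of_dilate s0 bSK.
  have FdS : F (dilate s S) by exact: convex_family_dilate.
  have fdK := body_fin Kdil; have pdK := body_pos FF FdS Kdil.
  apply: (sub_expand n0 FF FdS Kdil _ Pz).
  apply: (@lt_le_trans _ _ (leb (P `&` ~` E))); last first.
    apply: le_outer_measure => w [Pw nEw]; split => //; apply: UEO; split => //.
    by exists (y, s).
  have Psplit := mE P.
  have fP : leb P \is a fin_num by exact: fsub.
  have fP1 := fsub _ (subset_trans (@subIsetl _ P E) PQ).
  have fP2 := fsub _ (subset_trans (@subIsetl _ P (~` E)) PQ).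
  have PK : leb P = leb (dilate s K) by rewrite /P lebesgue_translate.
  have {}Psplit : fine (leb P) = fine (leb (P `&` E)) + fine (leb (P `&` ~` E)).
    by apply: EFin_inj; rewrite EFinD !fineK.
  have {}half : (leb (P `&` E) <= (2^-1)%:E * leb P)%E by rewrite PK setIC.
  rewrite -PK; move: half; rewrite -(fineK fP1) -(fineK fP2) -(fineK fP).
  rewrite -!EFinM lee_fin lte_fin => half.
  have p0 : 0 < fine (leb P) by apply: fine_gt0; rewrite PK pdK ltey_eq fdK.
  have : low_density * fine (leb P) < 2^-1 * fine (leb P).
    by rewrite ltr_pM2r//; exact: low_density_lt_half.
  by move: Psplit half => /=; lra.
have UC : (leb U <= C%:E * leb (U `\` E))%E.
  apply/lee_addgt0Pr => e e0.
  have eC : 0 < e / C by rewrite divr_gt0.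
  have ltUE : (leb (U `\` E) < +oo)%E by rewrite ltey_eq fUE.
  have [V [oV UEV leV]] := lebesgue_outer_regular eC ltUE.
  apply: (@le_trans _ _ (leb (expand V))).
    by apply: le_outer_measure; exact: UO.
  apply: le_trans (HC _ oV) _.
  apply: (@le_trans _ _ (C%:E * (leb (U `\` E) + (e / C)%:E))%E).
    by apply: lee_wpmul2l => //; rewrite lee_fin ltW.
  rewrite -(fineK fUE) -EFinD -!EFinM -EFinD lee_fin mulrDr.
  by rewrite [C * (e / C)]mulrC divfK ?gt_eqF.
apply: (@le_trans _ _ (leb U)); last by apply: le_outer_measure => z Uz; split; [exact: UE|exact: UQ].
have Usplit := mE U; rewrite -setDE in Usplit.
have fUE' := fsub _ (subset_trans (@subIsetl _ U E) UQ).
have EQle : (leb (E `&` Q) <= leb (U `&` E))%E.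
  by apply: le_outer_measure => z EQz; split; [exact: EQU|case: EQz].
have EQU' : (leb (E `&` Q) <= leb U)%E by exact: le_outer_measure.
have {}Usplit : fine (leb U) = fine (leb (U `&` E)) + fine (leb (U `\` E)).
  by apply: EFin_inj; rewrite EFinD !fineK.
move: UC EQle EQU'.
rewrite -(fineK fU) -(fineK fUE) -(fineK fUE') -(fineK fEQ).
rewrite -!EFinM !lee_fin => UC EQle EQU'.
(* In [|U| = |U /\ E| + |U \ E|] the first term is at least [|E /\ Q|], and the second is at least
   [|U| / C], hence at least [|E /\ Q| / C]. *)
rewrite mulrDl mul1r Usplit; apply: lerD => //.
rewrite mulrC ler_pdivrMr// mulrC; apply: le_trans UC; exact: EQU'.
Qed.

Lemma open_iter_expand k E : open E -> open (iter k expand E).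
Proof. by move=> oE; elim: k => //= k IH; exact: open_expand. Qed.

(** Each expansion multiplies the density in [x + K] by at least [1 + 1/C] until it exceeds 1/2; one
    further expansion then contains the whole of [x + K], hence the exponent [k.+1]. *)
Lemma sub_iter_expand (C : R) S K c x k E l : 1 <= C ->
  (forall O, open O -> (leb (expand O) <= C%:E * leb O)%E) ->
  F S -> body_of S K c -> open E ->
  (l%:E * leb K < leb (E `&` translate x K))%E -> 2^-1 <= (1 + C^-1) ^+ k * l ->
  translate x K `<=` iter k.+1 expand E.
Proof.
move=> C1 HC FS bSK; have [sK SK KS] := bSK.
have Kfin := body_fin bSK; have Kpos := body_pos FF FS bSK.
have k0 : 0 < fine (leb K) by apply: fine_gt0; rewrite Kpos ltey_eq Kfin.
have a1 : 1 <= 1 + C^-1 by rewrite lerDl invr_ge0 (le_trans _ C1).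
have big E' : open E' -> ((2^-1)%:E * leb K < leb (E' `&` translate x K))%E ->
    translate x K `<=` expand E'.
  move=> oE' lt; apply: (sub_expand n0 FF FS bSK); apply: le_lt_trans lt.
  apply: lee_wpmul2r => //; rewrite lee_fin; exact/ltW/low_density_lt_half.
elim: k E l => [|k IH] E l oE lE kl.
  apply: big => //; apply: le_lt_trans lE; apply: lee_wpmul2r => //.
  by rewrite lee_fin; move: kl; rewrite expr0 mul1r.
rewrite iterSr.
have [QE|/negP] := boolP (((2^-1)%:E * leb K < leb (E `&` translate x K))%E).
  (* The density is now 1. The value 3/4 is below 1, as the strict inequality requires, and at least
     1/2. *)
  apply: (IH _ (3 / 4)); first exact: open_expand.
    rewrite (_ : _ `&` _ = translate x K); last by apply/setIidr; exact: big.
    rewrite lebesgue_translate -(fineK Kfin) -EFinM lte_fin; lra.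
  have : 1 <= (1 + C^-1) ^+ k by rewrite exprn_ege1.
  by move: ((1 + C^-1) ^+ k) => z; lra.
move=> /negP; rewrite -leNgt => Qlow.
apply: (IH _ ((1 + C^-1) * l)); first exact: open_expand.
  apply: lt_le_trans (expand_growth C1 HC FS bSK oE Qlow).
  by rewrite EFinM -muleA lte_pmul2l// lte_fin (lt_le_trans _ a1).
by rewrite mulrA -exprSr.
Qed.

End growth.

(** * Power bound for the weak type constants *)

Section power_bound.
Context (R : realType) (n : nat) (F : set (set 'rV[R]_n)).
Hypothesis n0 : (0 < n)%N.
Hypothesis FF : convex_family F.
Implicit Types (A E S V W K : set 'rV[R]_n) (x y c t : 'rV[R]_n) (l r s : R).

Local Notation leb := (lebesgue_outer_measure R n).
Local Notation expand := (@expand R n F).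

Lemma exists_exprn_ge (a M : R) : 1 < a -> exists p : nat, M <= a ^+ p.
Proof.
move=> a1; have a10 : 0 < a - 1 by rewrite subr_gt0.
have bern (p : nat) : 1 + p%:R * (a - 1) <= a ^+ p.
  elim: p => [|p IH]; first by rewrite mul0r addr0 expr0.
  have a0 : 0 <= a by lra.
  rewrite exprS; apply: le_trans (ler_wpM2l a0 IH).
  have : 0 <= p%:R * (a - 1) ^+ 2 :> R by rewrite mulr_ge0// sqr_ge0.
  rewrite -natr1; move: (p%:R : R) => z; nra.
have [M0|M0] := leP M 0.
  by exists 0; rewrite expr0; lra.
exists (Num.bound (M / (a - 1))).
have := archi_boundP (divr_ge0 (ltW M0) (ltW a10)).
rewrite ltr_pdivrMr// => /ltW; move: (bern (Num.bound (M / (a - 1)))).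
by move: (_%:R * _) (a ^+ _) => u v; lra.
Qed.

Lemma iter_expand_le (C : R) k E : 0 <= C -> open E ->
  (forall V, open V -> (leb (expand V) <= C%:E * leb V)%E) ->
  (leb (iter k expand E) <= (C ^+ k)%:E * leb E)%E.
Proof.
move=> C0 oE HC; elim: k => [|k IH]; first by rewrite expr0 mul1e.
rewrite iterS; apply: le_trans (HC _ (@open_iter_expand _ _ _ FF k _ oE)) _.
by rewrite exprS EFinM -muleA; apply: lee_wpmul2l.
Qed.

Lemma body_lebesgue_le S K c : body_of S K c ->
  (((6 * n%:R)^-1 ^+ n)%:E * leb K <= leb S)%E.
Proof.
move=> [_ _ KS]; have d0 : 0 < (6 * n%:R)^-1 :> R by rewrite invr_gt0 mulr_gt0// ltr0n.
rewrite -lebesgue_dilate// -(lebesgue_translate c); apply: le_outer_measure => z.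
move=> /KS; rewrite scalerA mulfV ?gt_eqF// scale1r.
by rewrite addrC subrK.
Qed.

(** [p] expansions gain a factor 4 in the density, and [k] more make up for the loss [d] in passing
    from [S] to [K]; so [p j + k] steps raise the density [4^-j d] to 1/2. With the last expansion
    the cost is [C^(k+1) (C^p)^j], and [D] is chosen with [C^p <= 2^D]. *)
Theorem halo_power_bound : exists (C : R) (D : nat), 0 < C /\ forall j E, open E ->
  (leb (halo F (4^-1 ^+ j) E) <= (C * 2 ^+ (D * j))%:E * leb E)%E.
Proof.
have [C C1 HC] := expand_le n0 FF; have C0 : 0 < C by exact: lt_le_trans C1.
pose d : R := (6 * n%:R)^-1 ^+ n.
have d0 : 0 < d by rewrite exprn_gt0// invr_gt0 mulr_gt0// ltr0n.
pose a := 1 + C^-1.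
have a1 : 1 < a by rewrite ltrDl invr_gt0.
have [p ap] := exists_exprn_ge 4 a1.
have [k ak] := exists_exprn_ge ((2 * d)^-1) a1.
have [D DC] := exists_exprn_ge (C ^+ p) (ltr1n R 2).
exists (C ^+ k.+1), D; split; first by rewrite exprn_gt0.
move=> j E oE; pose m := (p * j + k)%N.
have am : 2^-1 <= a ^+ m * (4^-1 ^+ j * d).
  rewrite /m exprD exprM mulrACA -exprMn.
  have h1 : 1 <= (a ^+ p / 4) ^+ j by rewrite exprn_ege1// ler_pdivlMr// mul1r.
  have h2 : 2^-1 <= a ^+ k * d.
    by rewrite -ler_pdivrMr// -invfM.
  by apply: le_trans h2 _; rewrite ler_peMl// mulr_ge0 ?ltW// exprn_gt0//; lra.
apply: (@le_trans _ _ (leb (iter m.+1 expand E))).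
  apply: le_outer_measure => x [S FS lS]; have [K [c bSK]] := exists_body_of n0 FF FS.
  have [sK SK KS] := bSK.
  have : (((4^-1 ^+ j) * d)%:E * leb K < leb (E `&` translate x K))%E.
    rewrite EFinM -muleA; apply: (@le_lt_trans _ _ ((4^-1 ^+ j)%:E * leb S)%E).
      by apply: lee_wpmul2l; [rewrite lee_fin exprn_ge0|exact: body_lebesgue_le bSK].
    by apply: lt_le_trans lS _; apply: le_outer_measure; apply: setIS => z /SK.
  move=> lK; apply: (sub_iter_expand n0 FF C1 HC FS bSK oE lK am).
  by rewrite /translate /= subrr; apply: SK; exact: convex_family0 FF _ FS.
apply: le_trans (iter_expand_le _ (ltW C0) oE HC) _.
apply: lee_wpmul2r; first exact: outer_measure_ge0.
rewrite lee_fin /m -addnS exprD mulrC exprM [2 ^+ _]exprM.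
apply: ler_wpM2l; first by rewrite exprn_ge0// ltW.
by rewrite lerXn2r ?nnegrE ?exprn_ge0// ltW.
Qed.

End power_bound.

(** * Differentiation *)

Section averages.
Context (R : realType) (n : nat).
Implicit Types (A E S : set 'rV[R]_n) (x y : 'rV[R]_n) (f : 'rV[R]_n -> R).

Local Notation leb := (lebesgue_outer_measure R n).
Local Notation LT := (lebesgue_type R n).
Local Notation mu := (lebesgue R n).

Lemma derivatives_eq (B : 'rV[R]_n -> set (set 'rV[R]_n)) f x (v : R) :
  (forall d, 0 < d -> small_sets B x d !=set0) ->
  (forall e, 0 < e -> exists2 d, 0 < d & forall E, small_sets B x d E ->
     ((v - e)%:E <= average f E <= (v + e)%:E)%E) ->
  upper_derivative B f x = v%:E /\ lower_derivative B f x = v%:E.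
Proof.
move=> ne H.
have common e d : 0 < e -> 0 < d -> exists2 E, small_sets B x d E &
    ((v - e)%:E <= average f E <= (v + e)%:E)%E.
  move=> /H[d' d'0 Hd'] d0; have [|E [BE Ed]] := ne (Num.min d d').
    by rewrite lt_min d0.
  have Ed1 : (diam E < d%:E)%E.
    by apply: lt_le_trans Ed _; rewrite lee_fin ge_min lexx.
  exists E => //; apply: Hd'; split => //.
  by apply: lt_le_trans Ed _; rewrite lee_fin ge_min lexx orbT.
split; apply/eqP; rewrite eq_le; apply/andP; split.
- apply/lee_addgt0Pr => e e0; have [d d0 Hd] := H e e0.
  apply: (@le_trans _ _ (ereal_sup (average f @` small_sets B x d))).
    by apply: ereal_inf_lbound; exists d.
  by apply: ge_ereal_sup => _ [E /Hd /andP[_ +] <-].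
- apply/lee_subgt0Pr => e e0; apply: le_ereal_inf_tmp => _ [d /= d0 <-].
  have [E sE /andP[vE _]] := common _ _ e0 d0.
  by apply: ereal_sup_ge; exists (average f E) => //; exists E.
- apply/lee_addgt0Pr => e e0; apply: ge_ereal_sup => _ [d /= d0 <-].
  have [E sE /andP[_ vE]] := common _ _ e0 d0.
  by apply: le_trans vE; apply: ereal_inf_lbound; exists E.
- apply/lee_subgt0Pr => e e0; have [d d0 Hd] := H e e0.
  apply: ereal_sup_ge; exists (ereal_inf (average f @` small_sets B x d)).
    by exists d.
  by apply: le_ereal_inf_tmp => _ [E /Hd /andP[+ _] <-].
Qed.

Lemma small_sets_nonempty (B : 'rV[R]_n -> set (set 'rV[R]_n)) x (d : R) :
  differentiation_basis B -> 0 < d -> small_sets B x d !=set0.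
Proof.
move=> dB d0; have [E_ [BE cE]] := (dB x).2.
have : nbhs (0%E : \bar R) [set y | (y < d%:E)%E].
  by apply: open_nbhs_nbhs; split; [exact: open_ereal_lt_ereal|rewrite /= lte_fin].
by move=> /cE[k _ Hk]; exists (E_ k); split => //; apply: Hk => /=.
Qed.

Lemma lower_derivative_indic_ge (B : 'rV[R]_n -> set (set 'rV[R]_n)) S x (e : R) :
  differentiation_basis B -> measurable (S : set LT) -> 0 < e ->
  (1 <= lower_derivative B \1_S x)%E ->
  exists2 d : R, 0 < d & forall E, small_sets B x d E ->
    ((1 - e)%:E * leb E <= leb (S `&` E))%E.
Proof.
move=> dB mS e0 low1.
have : ((1 - e)%:E < lower_derivative B \1_S x)%E.
  by apply: lt_le_trans low1; rewrite lte_fin; lra.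
move=> /ereal_sup_gt[_ [d /= d0 <-] lt_inf]; exists d => // E sE.
have [bE mE E0 _] := (dB x).1 _ sE.1.
have fE : leb E \is a fin_num.
  by rewrite ge0_fin_numE ?outer_measure_ge0//; exact: bounded_lebesgue_lty.
have : ((1 - e)%:E <= average \1_S E)%E.
  by apply: le_trans (ltW lt_inf) _; apply: ereal_inf_lbound; exists E.
have e0' : 0 < fine (leb E) by apply: fine_gt0; rewrite E0 ltey_eq fE.
rewrite /average integral_indic//.
rewrite -[X in ((X)^-1 * _)%E](fineK fE) inver gt_eqF// muleC.
rewrite -(@lee_pmul2r _ (fine (leb E))%:E)// -[leRHS]muleA.
rewrite -[X in (_ <= _ * X)%E]EFinM mulVf ?gt_eqF// mule1 fineK//.
Qed.

Lemma average_near f E (v e : R) : measurable (E : set LT) ->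
  leb E \is a fin_num -> (0 < leb E)%E -> mu.-integrable E (EFin \o f) ->
  (\int[mu]_(y in E) `|f y - v|%:E <= e%:E * leb E)%E ->
  ((v - e)%:E <= average f E <= (v + e)%:E)%E.
Proof.
move=> mE fE E0 intf le_e.
have e0 : 0 < fine (leb E) by apply: fine_gt0; rewrite E0 ltey_eq fE.
have intv : mu.-integrable E (EFin \o cst v).
  apply: measurable_bounded_integrable => //; first by rewrite ltey_eq fE.
  by exists `|v|; split => // M vM y _ /=; exact: ltW.
have EI : (\int[mu]_(y in E) ((f y)%:E - v%:E) =
    \int[mu]_(y in E) (f y)%:E - v%:E * leb E)%E.
  rewrite (integralB mE intf intv); congr (_ - _)%E.
  by rewrite -(integral_cst mu mE).
have abs_le : (`|\int[mu]_(y in E) (f y)%:E - v%:E * leb E| <= e%:E * leb E)%E.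
  have mfv := emeasurable_funB (measurable_int _ intf) (measurable_int _ intv).
  rewrite -EI; exact: le_trans (le_abse_integral mu mE mfv) le_e.
have fI : (\int[mu]_(y in E) (f y)%:E)%E \is a fin_num by exact: integrable_fin_num intf.
have avgE : average f E = ((fine (leb E))^-1 * fine (\int[mu]_(y in E) (f y)%:E))%:E.
  by rewrite /average -[X in ((X)^-1 * _)%E](fineK fE) inver gt_eqF// EFinM fineK.
move: abs_le; rewrite avgE -(fineK fI) -(fineK fE) -!EFinM -EFinB.
rewrite !lee_fin /= ler_norml => /andP[h1 h2].
by rewrite ![_^-1 * _]mulrC ler_pdivlMr// ler_pdivrMr//; apply/andP; split; lra.
Qed.

End averages.

(** * Mean oscillation of a function on a set *)

Section oscillation.
Context (R : realType) (n : nat).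
Implicit Types (A E S : set 'rV[R]_n) (x y : 'rV[R]_n) (f : 'rV[R]_n -> R).

Local Notation leb := (lebesgue_outer_measure R n).
Local Notation LT := (lebesgue_type R n).
Local Notation mu := (lebesgue R n).

Definition large_values f j : set 'rV[R]_n := [set y | 2 ^+ j <= `|f y|].

Lemma measurable_large_values f j : measurable_fun [set: LT] (f : LT -> R) ->
  measurable (large_values f j : set LT).
Proof.
move=> mf; have mnf : measurable_fun [set: LT] (fun y => `|f y|).
  by apply: measurableT_comp mf.
have := mnf measurableT `[2 ^+ j, +oo[%classic (measurable_itv _).
rewrite setTI; congr (measurable _).
by apply/seteqP; split => y; rewrite /large_values /= in_itv/= andbT.
Qed.

Lemma large_values_ge f y J : 2 ^+ J <= `|f y| ->
  exists i, large_values f (J + i) y /\ `|f y| < 2 ^+ (J + i).+1.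
Proof.
move=> yJ; have exm : exists m, `|f y| < 2 ^+ m.
  exists (Num.bound `|f y|); apply: lt_le_trans (archi_boundP (normr_ge0 _)) _.
  by rewrite -natrX ler_nat ltnW// ltn_expl.
case: (ex_minnP exm) => -[|m] ym minm.
  have J1 : 1 <= 2 ^+ J :> R by rewrite exprn_ege1// ler1n.
  by move: (le_trans J1 yJ); rewrite leNgt; move: ym; rewrite expr0 => ->.
have Jm : (J <= m)%N.
  rewrite leqNgt; apply/negP => mJ; have := le_lt_trans yJ ym.
  by rewrite ltNge ler_weXn2l// ler1n.
exists (m - J)%N; rewrite subnKC//; split => //; rewrite /large_values /= leNgt.
by apply/negP => /minm; rewrite ltnn.
Qed.

(** A pointwise bound for [|f - v|]: [a] on [S]; off [S], [2^J + |v|] where [|f| < 2^J], and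
    [|v| + 2^(J+i+1)] where [|f|] is between [2^(J+i)] and [2^(J+i+1)]. Full level sets stand in the
    series since the density bounds are for them. *)
Definition oscillation_majorant f S (v a : R) J y : \bar R :=
  (a%:E + ((2 ^+ J + `|v|)%:E * (\1_(~` S) y)%:E +
    \sum_(0 <= i <oo) ((2 ^+ (J + i).+1)%:E * (\1_(large_values f (J + i)) y)%:E)))%E.

Let term_ge0 f J y i :
  (0 <= (2 ^+ (J + i).+1)%:E * (\1_(large_values f (J + i)) y)%:E :> \bar R)%E.
Proof. by rewrite -EFinM lee_fin mulr_ge0// exprn_ge0. Qed.

Let series_ge0 f J y :
  (0 <= \sum_(0 <= i <oo)
    ((2 ^+ (J + i).+1)%:E * (\1_(large_values f (J + i)) y)%:E) :> \bar R)%E.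
Proof. by apply: nneseries_ge0 => i _ _; exact: term_ge0. Qed.

Lemma le_oscillation_majorant f S (v a : R) J y : 0 <= a ->
  (S y -> `|f y - v| <= a) ->
  (`|f y - v|%:E <= oscillation_majorant f S v a J y)%E.
Proof.
move=> a0 Sa; rewrite /oscillation_majorant.
have b0 : 0 <= 2 ^+ J + `|v| by rewrite addr_ge0// exprn_ge0.
have [Sy|nSy] := pselect (S y).
  rewrite -[leLHS]adde0; apply: leeD; first by rewrite lee_fin; exact: Sa.
  by apply: adde_ge0 => //; rewrite -EFinM lee_fin mulr_ge0.
rewrite -[leLHS]add0e; apply: leeD; first by rewrite lee_fin.
rewrite indicE mem_set// mule1.
have [fJ|/large_values_ge[i [Gi fi]]] := ltP `|f y| (2 ^+ J).
  rewrite -[leLHS]adde0; apply: leeD => //; rewrite lee_fin.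
  by rewrite (le_trans (ler_normB _ _))// lerD// ltW.
apply: (@le_trans _ _ (`|v|%:E + (2 ^+ (J + i).+1)%:E)%E).
  by rewrite -EFinD lee_fin (le_trans (ler_normB _ _))// addrC lerD// ltW.
apply: leeD; first by rewrite lee_fin lerDr exprn_ge0.
apply: le_trans (nneseries_lim_ge i.+1 _); last by move=> k _ _; exact: term_ge0.
rewrite big_nat_recr//= indicE mem_set// mule1.
by apply: leeDr; apply: sume_ge0 => k _; exact: term_ge0.
Qed.

(** Relative to [|E|], the three terms of the majorant contribute at most [a], [(2^J + |v|) e], and
    the sum over [j >= J] of [2^(j+1) 4^-j], which is [4 2^-J]. The densities [4^-j] are chosen to
    make this series converge. *)
Lemma oscillation_integral_le f E S (v a e : R) J :
  measurable_fun [set: LT] (f : LT -> R) ->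
  measurable (E : set LT) -> measurable (S : set LT) -> leb E \is a fin_num ->
  0 <= a -> (forall y, S y -> `|f y - v| <= a) ->
  ((1 - e)%:E * leb E <= leb (S `&` E))%E ->
  (forall j, (J <= j)%N -> (leb (large_values f j `&` E) <= (4^-1 ^+ j)%:E * leb E)%E) ->
  (\int[mu]_(y in E) `|f y - v|%:E <=
    (a + ((2 ^+ J + `|v|) * e + 4 * 2^-1 ^+ J))%:E * leb E)%E.
Proof.
move=> mf mE mS fE a0 Sa SE GE.
have mG j := measurable_large_values j mf.
have b0 : 0 <= 2 ^+ J + `|v| by rewrite addr_ge0// exprn_ge0.
have mSC : measurable (~` S : set LT) by exact: measurableC.
have mf1 : measurable_fun (E : set LT) (fun y => `|f y - v|%:E : \bar R).
  have mfv : measurable_fun (E : set LT) (fun y => f y - v).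
    by apply: measurable_funB; [exact: measurable_funTS|exact: measurable_cst].
  by apply/measurable_EFinP; apply: measurableT_comp mfv.
have mind A (k : R) : measurable (A : set LT) ->
    measurable_fun (E : set LT) (fun y => k%:E * (\1_A y)%:E : \bar R)%E.
  by move=> mA; apply: measurable_funeM; apply/measurable_EFinP; exact: measurable_indic.
have ind0 A (k : R) y : 0 <= k -> (0 <= k%:E * (\1_A y)%:E :> \bar R)%E.
  by move=> k0; rewrite -EFinM lee_fin mulr_ge0.
pose g2 := (fun y => (2 ^+ J + `|v|)%:E * (\1_(~` S) y)%:E : \bar R)%E.
pose g3 := (fun y => \sum_(0 <= i <oo)
    ((2 ^+ (J + i).+1)%:E * (\1_(large_values f (J + i)) y)%:E) : \bar R)%E.
have mg2 : measurable_fun (E : set LT) g2 by exact: mind.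
have mg3 : measurable_fun (E : set LT) g3.
  apply: ge0_emeasurable_sum; first by move=> i y _ _; exact: term_ge0.
  by move=> i _; exact: mind.
have I2 : (\int[mu]_(y in E) g2 y <= ((2 ^+ J + `|v|) * e)%:E * leb E)%E.
  rewrite integral_indic_scaled// EFinM -muleA; apply: lee_wpmul2l => //.
  have fin A : A `<=` E -> leb A \is a fin_num.
    move=> AE; rewrite ge0_fin_numE ?outer_measure_ge0//.
    by apply: le_lt_trans (_ : leb E < +oo)%E; [exact: le_outer_measure|rewrite ltey_eq fE].
  have f1 : leb (S `&` E) \is a fin_num by exact: fin.
  have f2 : leb (~` S `&` E) \is a fin_num by exact: fin.
  have split : fine (leb E) = fine (leb (S `&` E)) + fine (leb (~` S `&` E)).
    by apply: EFin_inj; rewrite EFinD !fineK// ![_ `&` E]setIC; exact: mS.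
  move: SE; rewrite -(fineK f1) -(fineK f2) -(fineK fE) -!EFinM !lee_fin /=; lra.
have I3 : (\int[mu]_(y in E) g3 y <= (4 * 2^-1 ^+ J)%:E * leb E)%E.
  have -> := @integral_nneseries _ LT R mu E mE _
    (fun i => mind _ (2 ^+ (J + i).+1) (mG (J + i)%N)) (fun i y _ => term_ge0 f J y i).
  rewrite -(fineK fE) -EFinM.
  have k0 : 0 <= 4 * 2^-1 ^+ J * fine (leb E).
    by rewrite !mulr_ge0// ?exprn_ge0//; exact/fine_ge0/outer_measure_ge0.
  apply: le_trans (epsilon_trick0 xpredT k0).
  apply: lee_nneseries => [i _ _|i _]; first by apply: integral_ge0 => y _; exact: term_ge0.
  rewrite integral_indic_scaled ?exprn_ge0//.
  apply: (@le_trans _ _ ((2 ^+ (J + i).+1)%:E * ((4^-1 ^+ (J + i))%:E * leb E))%E).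
    by apply: lee_wpmul2l; [rewrite lee_fin exprn_ge0|exact/GE/leq_addr].
  rewrite -(fineK fE) -!EFinM lee_fin /= natrX.
  rewrite (_ : 4^-1 = 2^-1 * 2^-1 :> R); last by rewrite -invfM; congr _^-1; ring.
  rewrite exprMn exprS exprD -(exprVn _ i.+1) [2^-1 ^+ i.+1]exprS.
  have hh m : 2 ^+ m * 2^-1 ^+ m = 1 :> R by rewrite -exprMn mulfV// expr1n.
  rewrite le_eqVlt; apply/orP; left; apply/eqP.
  rewrite [2^-1 ^+ (J + i)]exprD.
  move: (hh J) (hh i); move: (2 ^+ J) (2 ^+ i) (2^-1 ^+ J) (2^-1 ^+ i) => p q p' q' pp qq.
  have -> : 2 * (p * q) * (p' * q' * (p' * q') * fine (leb E)) =
     2 * (p * p') * (q * q') * (p' * q' * fine (leb E)) by ring.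
  by rewrite pp qq; field.
have g20 y : E y -> (0 <= g2 y)%E by move=> _; exact: ind0.
have g30 y : E y -> (0 <= g3 y)%E by move=> _; exact: series_ge0.
have g230 y : E y -> (0 <= g2 y + g3 y)%E.
  by move=> Ey; apply: adde_ge0; [exact: g20|exact: g30].
have mg23 := emeasurable_funD mg2 mg3.
have mcst : measurable_fun (E : set LT) (fun=> a%:E : \bar R) by exact: measurable_cst.
have cst0 y : E y -> (0 <= a%:E :> \bar R)%E by rewrite lee_fin.
have maj y : E y -> (`|f y - v|%:E <= a%:E + (g2 y + g3 y))%E.
  by move=> _; apply: le_oscillation_majorant => //; exact: Sa.
have abs0 y : E y -> (0 <= `|f y - v|%:E :> \bar R)%E by rewrite lee_fin.
apply: (le_trans (@ge0_le_integral _ LT R mu E mE _ _ abs0 mf1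
  (emeasurable_funD mcst mg23) maj)).
rewrite (@ge0_integralD _ LT R mu E mE _ _ cst0 mcst g230 mg23).
rewrite (@ge0_integralD _ LT R mu E mE _ _ g20 mg2 g30 mg3).
have -> : (\int[mu]_(y in E) a%:E = a%:E * leb E)%E by exact: (integral_cst mu mE).
apply: le_trans (leeD (le_refl _) (leeD I2 I3)) _.
by rewrite -(fineK fE) -!EFinM -!EFinD lee_fin /= -!mulrDl.
Qed.

End oscillation.

(** * Differentiation of integrals of functions in L^p *)

Section differentiation_of_Lp.
Context (R : realType) (n : nat).
Variable B : 'rV[R]_n -> set (set 'rV[R]_n).
Implicit Types (A E S : set 'rV[R]_n) (x y : 'rV[R]_n) (f : 'rV[R]_n -> R).

Local Notation leb := (lebesgue_outer_measure R n).
Local Notation LT := (lebesgue_type R n).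
Local Notation mu := (lebesgue R n).
Local Notation cube := (@centered_cube R n).

Lemma basis_convex_family : differentiation_basis B -> homothecy_invariant B ->
  convex_basis B -> density_basis B -> convex_family (B 0).
Proof.
move=> dB hB cB densB; split.
- by move=> S BS; have [_ + _ _] := (dB 0).1 _ BS.
- by move=> S BS; have [/bounded_setP[r _ ?] _ _ _] := (dB 0).1 _ BS; exists r.
- by move=> S BS; have [_ _ + _] := (dB 0).1 _ BS.
- by move=> S BS; have [_ _ _] := (dB 0).1 _ BS.
- by move=> S BS; exact: cB BS.
- by move=> S s s0; exact: basis_dilate.
- by move=> l l0; exact: density_basis_halo_weak_type.
Qed.

(** Chebyshev's inequality for [|f|^p]: where [|f| >= 2^j], one has
    [|f|^p >= 2^(p j) >= 2^((D+1) j)]. *)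
Lemma large_values_le f (p : R) (D : nat) : f \in Lfun mu p%:E -> D.+1%:R <= p ->
  exists2 A : R, 0 <= A & forall j,
    (leb (large_values f j) <= (A * 2^-1 ^+ (D.+1 * j))%:E)%E.
Proof.
move=> fp Dp; have p1 : 1 <= p by apply: le_trans Dp; rewrite ler1n.
have p0 : 0 <= p by exact: le_trans p1.
have intf := Lfun_integrable p1 fp.
pose g : LT -> \bar R := fun y => (`|f y| `^ p)%:E.
have mg : measurable_fun [set: LT] g by exact: measurable_int intf.
have intg : (\int[mu]_y `|g y|)%E \is a fin_num.
  by apply: integrable_fin_num => //; exact: integrable_abse.
exists (fine (\int[mu]_y `|g y|)%E).
  by apply: fine_ge0; apply: integral_ge0 => y _; exact: abse_ge0.
move=> j; have a0 : 0 < 2 ^+ (D.+1 * j) :> R by rewrite exprn_gt0.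
have := le_integral_abse mu measurableT mg a0.
rewrite EFinM fineK// exprVn [X in (_ -> _ <= X)%E]muleC => le_int.
rewrite lee_pdivlMl//; apply: le_trans le_int.
apply: lee_wpmul2l; first by rewrite lee_fin ltW.
apply: (@le_outer_measure _ _ leb) => y jy; split => //=.
rewrite lee_fin ger0_norm ?powR_ge0//.
have j1 : 1 <= 2 ^+ j :> R by rewrite exprn_ege1// ler1n.
apply: (@le_trans _ _ ((2 ^+ j) `^ p)).
  apply: (@le_trans _ _ ((2 ^+ j) `^ D.+1%:R)).
    by rewrite powR_mulrn ?exprn_ge0// -exprM mulnC.
  exact: ler_powR.
by apply: ge0_ler_powR => //; rewrite nnegrE// exprn_ge0.
Qed.

(** The decay [2^(-(D+1) j)] of the level sets beats the growth [2^(D j)] of the halo bound by a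
    factor [2^-j], so the halos have summable measures and the Borel-Cantelli lemma applies. The
    [V_ j] are open enlargements of the level sets, as the halo bound is for open sets. *)
Lemma negligible_limsup_halo f (p C : R) (D : nat) (F : set (set 'rV[R]_n)) :
  f \in Lfun mu p%:E -> D.+1%:R <= p -> 0 < C ->
  (forall S, F S -> measurable (S : set LT)) ->
  (forall j E, open E ->
     (leb (halo F (4^-1 ^+ j) E) <= (C * 2 ^+ (D * j))%:E * leb E)%E) ->
  exists V_ : nat -> set 'rV[R]_n,
    [/\ forall j, open (V_ j), forall j, large_values f j `<=` V_ j &
    leb (lim_sup_set (fun j => halo F (4^-1 ^+ j) (V_ j))) = 0%E].
Proof.
move=> fp Dp C0 mF HC; have [A A0 HA] := large_values_le fp Dp.
have e0 j : 0 < 2^-1 ^+ (D.+1 * j) :> R by rewrite exprn_gt0.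
have fin j : (leb (large_values f j) < +oo)%E by apply: le_lt_trans (HA j) _; rewrite ltry.
have /choice[V_ HV] : forall j, exists V, [/\ open V, large_values f j `<=` V &
    (leb V <= ((A + 1) * 2^-1 ^+ (D.+1 * j))%:E)%E].
  move=> j; have [V [oV fVj leV]] := lebesgue_outer_regular (e0 j) (fin j).
  exists V; split => //; apply: le_trans leV _.
  by rewrite mulrDl mul1r EFinD; apply: leeD.
exists V_; split; [by move=> j; have [] := HV j|by move=> j; have [] := HV j|].
apply: (@lim_sup_set_cvg0 _ LT R mu).
  move=> j; apply/open_lebesgue_measurable/open_halo => //.
  by have [] := HV j.
have c0 : 0 <= 2 * (C * (A + 1)) by rewrite !mulr_ge0 ?addr_ge0// ltW.
apply: le_lt_trans (_ : ((2 * (C * (A + 1)))%:E < +oo)%E); last by rewrite ltry.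
apply: le_trans (epsilon_trick0 xpredT c0).
apply: lee_nneseries => [j _ _|j _]; first exact: outer_measure_ge0.
have [oV _ leV] := HV j.
apply: le_trans (HC j _ oV) _.
apply: (@le_trans _ _ ((C * 2 ^+ (D * j))%:E * ((A + 1) * 2^-1 ^+ (D.+1 * j))%:E)%E).
  by apply: lee_wpmul2l => //; rewrite lee_fin mulr_ge0 ?exprn_ge0// ltW.
rewrite -EFinM lee_fin natrX mulSn exprD.
have hh : 2 ^+ (D * j) * 2^-1 ^+ (D * j) = 1 :> R by rewrite -exprMn mulfV// expr1n.
have -> : C * 2 ^+ (D * j) * ((A + 1) * (2^-1 ^+ j * 2^-1 ^+ (D * j))) =
  C * (A + 1) * 2^-1 ^+ j * (2 ^+ (D * j) * 2^-1 ^+ (D * j)) by ring.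
by rewrite hh mulr1 [2 ^+ j.+1]exprS invfM mulrACA mulfV// mul1r -exprVn.
Qed.

Lemma differentiates_Lfun f (p C : R) (D : nat) :
  differentiation_basis B -> homothecy_invariant B -> density_basis B -> 0 < C ->
  (forall j E, open E ->
     (leb (halo (B 0) (4^-1 ^+ j) E) <= (C * 2 ^+ (D * j))%:E * leb E)%E) ->
  D.+1%:R <= p -> f \in Lfun mu p%:E -> f \in Lfun mu 1 -> differentiates B f.
Proof.
move=> dB hB densB C0 HC Dp fp /Lfun1_integrable f1.
have mf : measurable_fun [set: LT] (f : LT -> R).
  exact/measurable_EFinP/(measurable_int _ f1).
have mB0 S : B 0 S -> measurable (S : set LT).
  by move=> BS; have [_ + _ _] := (dB 0).1 _ BS.
have [V_ [oV_ fV limsup0]] := negligible_limsup_halo fp Dp C0 mB0 HC.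
(* Rational bounds and integer radii leave countably many sets, hence a single null exceptional set;
   the cube makes them bounded, as [density_basis] requires. *)
pose level (q : rat * rat * nat) : set 'rV[R]_n :=
  [set y | ratr q.1.1 < f y <= ratr q.1.2] `&` cube q.2%:R.
have mlevel q : measurable (level q : set LT).
  apply: measurableI; last exact/open_lebesgue_measurable/open_centered_cube.
  have := mf measurableT `]ratr q.1.1, ratr q.1.2]%classic (measurable_itv _).
  by rewrite setTI.
have blevel q : bounded_set (level q).
  exists q.2%:R; split => // M qM y [_ /ltW yq]; exact: le_trans yq (ltW qM).
(* The triples are enumerated by their codes; a number that codes no triple imposes nothing. *)
pose Q k (x : LT) := if unpickle k is Some q then
  lower_derivative B \1_(level q) x = (\1_(level q) x)%:E else True.
have aeQ : {ae mu, forall x, forall k, Q k x}.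
  apply: ae_foralln => k; rewrite /Q; case: (unpickle k) => [q|]; last first.
    by apply: aeW.
  by apply: negligibleS (densB _ (blevel q) (mlevel q)) => x nQ [_ /nQ].
have aeO : {ae mu, forall x, ~ lim_sup_set (fun j => halo (B 0) (4^-1 ^+ j) (V_ j)) x}.
  exists (lim_sup_set (fun j => halo (B 0) (4^-1 ^+ j) (V_ j))); split => //.
  - apply: bigcapT_measurable => m; apply: bigcup_measurable => j _.
    exact/open_lebesgue_measurable/open_halo.
  - by move=> x /=; rewrite notK.
apply: negligibleS (negligibleU aeQ aeO) => x nP; apply: contrapT => nU; apply: nP.
have Qx : forall k, Q k x by apply: contrapT => nQ; apply: nU; left.
have Ox : ~ lim_sup_set (fun j => halo (B 0) (4^-1 ^+ j) (V_ j)) x.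
  by move=> Lx; apply: nU; right; apply.
apply: derivatives_eq => [d d0|e e0]; first exact: small_sets_nonempty.
have e30 : 0 < e / 3 by rewrite divr_gt0.
set v := f x.
have [J0 HJ0] : exists J0, forall j, (J0 <= j)%N -> ~ halo (B 0) (4^-1 ^+ j) (V_ j) x.
  apply: contrapT => nJ; apply: Ox => J _; apply: contrapT => nx; apply: nJ.
  by exists J => j Jj hx; apply: nx; exists j.
have [J1 HJ1] : exists J1 : nat, 4 * 2^-1 ^+ J1 < e / 3.
  have e12 : 0 < e / 3 / 4 by rewrite divr_gt0.
  have [m] := ltr_add_invr e12; rewrite add0r => me; exists m.+1.
  rewrite mulrC -ltr_pdivlMr//; apply: le_lt_trans me.
  rewrite exprVn lef_pV2 ?posrE ?exprn_gt0//.
  by rewrite -natrX ler_nat ltnW// ltn_expl.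
(* From [J0] on, [x] lies in none of the halos; from [J1] on, the tail [4 2^-J] is below [e / 3]. *)
pose J := maxn J0 J1.
have HJ : 4 * 2^-1 ^+ J < e / 3.
  apply: le_lt_trans HJ1; rewrite ler_pM2l// ler_wiXn2l ?leq_maxr//; lra.
have vl : v - e / 3 < v by rewrite ltrBlDr ltrDl.
have vr : v < v + e / 3 by rewrite ltrDl.
have [q1] := rat_in_itvoo vl; rewrite in_itv /= => /andP[q1l q1v].
have [q2] := rat_in_itvoo vr; rewrite in_itv /= => /andP[q2v q2l].
pose q := (q1, q2, Num.bound `|x|).
pose S := level q.
have Sx : S x by split; [rewrite /= q1v ltW|exact: archi_boundP].
have lowS : (1 <= lower_derivative B \1_S x)%E.
  have := Qx (pickle q); rewrite /Q pickleK => ->.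
  by rewrite indicE mem_set.
have Sosc y : S y -> `|f y - v| <= e / 3.
  by move=> [/= /andP[y1 y2] _]; rewrite ler_norml; apply/andP; split;
    move: q1l q2l y1 y2; clear; move: (f y) (ratr q1) (ratr q2) v => *; lra.
(* Off [S] the oscillation is charged at height [b], so the complement of [S] is required to have
   relative measure at most [e / (3 b)] in [E]. *)
pose b := 2 ^+ J + `|v|.
have b0 : 0 < b by rewrite ltr_wpDr// exprn_gt0.
have eb0 : 0 < e / 3 / b by rewrite divr_gt0.
have [d d0 Hd] := lower_derivative_indic_ge dB (mlevel q) eb0 lowS.
exists d => // E sE; have [BE _] := sE.
have [bE mE E0 _] := (dB x).1 _ BE.
have fE : leb E \is a fin_num.
  by rewrite ge0_fin_numE ?outer_measure_ge0//; exact: bounded_lebesgue_lty.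
(* A density above [4^-j] would put [x] in the halo of [V_ j], after translation of [E] to a set of
   [B 0], against [HJ0]. *)
have lv j : (J <= j)%N -> (leb (large_values f j `&` E) <= (4^-1 ^+ j)%:E * leb E)%E.
  move=> Jj; rewrite leNgt; apply/negP => lt_j.
  apply: (HJ0 j); first exact: leq_trans (leq_maxl _ _) Jj.
  exists (translate (- x) E); first exact: basis_origin.
  rewrite lebesgue_translate -translateD subrr.
  rewrite (_ : translate 0 E = E); last by apply/funext => y; rewrite /translate /= subr0.
  by apply: lt_le_trans lt_j _; apply: le_outer_measure; apply: setSI; exact: fV.
have osc := oscillation_integral_le mf mE (mlevel q) fE (ltW e30) Sosc (Hd _ sE) lv.
apply: average_near => //.
  exact: (integrableS measurableT mE (@subsetT _ E) f1).
apply: le_trans osc _; apply: lee_wpmul2r; first exact: outer_measure_ge0.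
have bK : b * (e / 3 / b) = e / 3 by rewrite mulrC divfK ?gt_eqF.
by rewrite lee_fin -/b bK; move: HJ; clear; lra.
Qed.

End differentiation_of_Lp.

Theorem mainTheorem6 (R : realType) (n : nat)
    (B : 'rV[R]_n -> set (set 'rV[R]_n)) :
  (2 <= n)%N ->
  differentiation_basis B ->
  homothecy_invariant B ->
  convex_basis B ->
  density_basis B ->
  exists p0 : R, forall p : R, p0 <= p ->
    differentiates_class B (Lp p%:E `&` Lp 1).
Proof.
move=> n2 dB hB cB densB; have n0 : (0 < n)%N by exact: leq_trans n2.
have [C [D [C0 HC]]] := halo_power_bound n0 (basis_convex_family dB hB cB densB).
exists D.+1%:R => p Dp f [fp f1].
exact: (differentiates_Lfun dB hB densB C0 HC Dp fp f1).
Qed.
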